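(* Let $\sigma:\mathbb{R}\to\mathbb{R}$ be an increasing odd homeomorphism, and suppose there are $a,b>0$ with $\sigma(x)=ax$ for all $x\in[-b,b]$. Then the Lebesgue measure is the only (Borel) measure $\mu$ on $\mathbb{R}_{\geq0}^2$ such that (i) $\mu([0,1]^2)=1$ and $\mu(\{0\}\times\mathbb{R}_{\geq0})=\mu(\mathbb{R}_{\geq0}\times\{0\})=0$, and (ii) for all Borel subsets $A\subset\mathbb{R}_{\geq0}^2$, $\mu(A)=\mu(h_\sigma(A))=\mu(v_\sigma(A))$.
   Context: $h_\sigma(x,y)=(x+\sigma^{-1}(y),y)$ and $v_\sigma(x,y)=(x,\sigma(x)+y)$; these maps send $\mathbb{R}_{\geq0}^2$ into itself. *)

(* Defs.v *)
From HB Require Import structures.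
From mathcomp Require Import all_boot all_order all_algebra.
From mathcomp Require Import all_classical all_reals all_analysis.
Set Implicit Arguments. Unset Strict Implicit. Unset Printing Implicit Defensive.
Import Order.TTheory GRing.Theory Num.Theory.
Local Open Scope classical_set_scope.
Local Open Scope ring_scope.

Definition quadrant (R : realType) : set (R * R) :=
  [set p | 0 <= p.1 /\ 0 <= p.2].

Definition hmap (R : realType) (sigmainv : R -> R) (p : R * R) : R * R :=
  (p.1 + sigmainv p.2, p.2).

Definition vmap (R : realType) (sigma : R -> R) (p : R * R) : R * R :=
  (p.1, sigma p.1 + p.2).

Local Open Scope ereal_scope.
Definition sigma_invariant_normalized (R : realType) (sigma sigmainv : R -> R)
    (m : set (R * R) -> \bar R) : Prop :=
  [/\ m ((`[0%R, 1%R])%classic `*` (`[0%R, 1%R])%classic) = 1,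
      m ([set 0%R] `*` [set y | (0 <= y)%R]) = 0,
      m ([set x | (0 <= x)%R] `*` [set 0%R]) = 0 &
      forall A : set (R * R), measurable A -> A `<=` @quadrant R ->
        m A = m (hmap sigmainv @` A) /\ m A = m (vmap sigma @` A)].

(* Main.v *)
Require Import Defs.
From HB Require Import structures.
From mathcomp Require Import all_boot all_order all_algebra.
From mathcomp Require Import all_classical all_reals all_analysis.
From mathcomp Require Import measurable_realfun ring lra zify.
Import Order.TTheory GRing.Theory Num.Theory numFieldNormedType.Exports.
Local Open Scope classical_set_scope.
Local Open Scope ring_scope.

(* For [x, y] large, let [f x y] be the mass of the triangle
   [{(u, w) >= 0 : x (a u) + y w <= 1}], on which [h] and [v] are linear.  The two
   maps cut it into two such triangles up to a null diagonal, so that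
   [f x y = f x (x + y) + f (x + y) y], like [1 / (x y)].  The defect
   [D x y = S / (x y) - f x y], with [S] the supremum of [x y f x y], is then
   nonnegative and additive, hence decreases along the moves
   [(x, y) -> (x, x + y)] and [(x, y) -> (x + y, y)].  From a far point where [D]
   is almost zero, the moves reach approximately every point of a whole band at
   a larger scale, and almost all of the mass of any given triangle is carried
   by its descendants in that band; therefore [D = 0] and [f x y = S / (x y)].
   Two invariant measures giving the same mass to these triangles agree on their
   intersections with rational sectors, by the Euclidean algorithm, hence on
   Borel subsets of a small triangle; the nonlinear Euclidean algorithm
   inverting [h] and [v] brings every other point into this triangle or onto an
   axis.  If [S] and [L] are the constants of [mu] and of the Lebesgue measure
   [lambda], then [L mu = S lambda], and the unit square gives [S = L]. *)

(** * Additive functions of pairs *)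

(** The subtractive Euclidean algorithm read backwards: subtracting the smaller entry from the
    larger keeps the pair coprime and lowers [A + B], and equal coprime entries are both 1. *)
Lemma coprime_ind (P : nat -> nat -> Prop) :
  P 1%N 1%N ->
  (forall A B, (0 < A)%N -> (0 < B)%N -> P A B -> P A (A + B)%N /\ P (A + B)%N B) ->
  forall A B, (0 < A)%N -> (0 < B)%N -> coprime A B -> P A B.
Proof.
move=> P1 PD A B; have [n] := ubnP (A + B).
elim: n A B => // n IH A B ABn A0 B0 AB; case: (ltngtP A B) => [lt|lt|eqAB].
- rewrite -(subnKC (ltnW lt)).
  have AB' : coprime A (B - A) by rewrite /coprime -gcdnDl subnKC// ltnW.
  by apply: (PD _ _ A0 _ _).1; [|apply: IH => //]; lia.
- rewrite -(subnK (ltnW lt)).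
  have AB' : coprime (A - B) B.
    by rewrite /coprime gcdnC -gcdnDl subnKC 1?ltnW// gcdnC.
  by apply: (PD _ _ _ B0 _).2; [|apply: IH => //]; lia.
- by move: AB; rewrite -eqAB /coprime gcdnn => /eqP ->.
Qed.

Section cone_additive.
Context {R : realType}.
Implicit Types (c x y s eta L : R) (D E f : R -> R -> R).

Definition cone_additive c E := forall x y, c <= x -> c <= y ->
  E x y = E x (x + y) + E (x + y) y.

Definition cone_decreasing c D := forall x y, c <= x -> c <= y ->
  D x (x + y) <= D x y /\ D (x + y) y <= D x y.

(** The properties of the masses of triangles on which the rigidity argument rests. The vanishing
    fields reflect that the triangles shrink to a segment of an axis, which is null; above [c] they
    lie where both maps are linear. *)
Record triangle_mass c f : Prop := TriangleMass {
  mass_ge0 : forall x y, c <= x -> c <= y -> 0 <= f x y;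
  mass_noninc : forall x y x' y', c <= x -> c <= y -> x <= x' -> y <= y' ->
    f x' y' <= f x y;
  mass_additive : cone_additive c f;
  mass_vanishl : forall x y e, c <= x -> c <= y -> 0 < e ->
    exists n, f x (y + x *+ n.+1) <= e;
  mass_vanishr : forall x y e, c <= x -> c <= y -> 0 < e ->
    exists n, f (x + y *+ n.+1) y <= e }.

Lemma triangle_mass_sym c f : triangle_mass c f -> triangle_mass c (fun x y => f y x).
Proof.
case=> f0 fle fD fl fr; split=> //.
- by move=> x y cx cy; exact: f0.
- by move=> x y x' y' cx cy xx' yy'; exact: fle.
- by move=> x y cx cy; rewrite addrC (fD _ _ cy cx) (addrC y).
- by move=> x y e cx cy; exact: fr.
- by move=> x y e cx cy; exact: fl.
Qed.

(* Iterating additivity on the left gives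
   [E x y = \sum_(k < n) E (y + (k+1) x) (y + k x) + E x (y + n x)]. *)
Lemma cone_additive_fan c E x y : 0 < c -> c <= x -> c <= y ->
  cone_additive c E ->
  (forall k, 0 <= E (y + x *+ k.+1) (y + x *+ k)) ->
  (forall e, 0 < e -> exists n, - e <= E x (y + x *+ n.+1)) ->
  E (x + y) y <= E x y.
Proof.
move=> c0 cx cy Ead E0 Elim.
have x0 : 0 < x by exact: lt_le_trans cx.
have cyn n : c <= y + x *+ n by rewrite ler_wpDr// mulrn_wge0// ltW.
have step n : E x (y + x *+ n) =
    E x (y + x *+ n.+1) + E (y + x *+ n.+1) (y + x *+ n).
  by rewrite (Ead _ _ cx (cyn n)) mulrS addrCA.
have fan n : E x (y + x *+ n.+1) <= E x (y + x *+ 1).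
  elim: n => // n IH; apply: le_trans IH.
  by rewrite [leRHS]step lerDl.
(* What remains is [0 <= E x (x + y)]: this value dominates the later terms [E x (y + x *+ n.+1)],
   one of which is at least [- e]. *)
rewrite [leRHS](Ead _ _ cx cy) lerDr; apply/ler_addgt0Pl => e e0.
have [n en] := Elim _ e0.
have := fan n; rewrite mulr1n [in leRHS]addrC; lra.
Qed.

(* The super-solution [bad]: it dominates, up to a factor 2, the part of
   [1 / (x y)] carried by the descendants that leave [{x + y <= L}] with one
   coordinate below [eta L]. *)
Definition bad1 (eta L x : R) : R := if x < eta * L then (L * x)^-1 else 0.

Definition bad (eta L x y : R) : R :=
  Num.max 0 (2 * eta * L - x - y) / (L * x * y) + bad1 eta L x + bad1 eta L y.

Lemma bad1_ge0 eta L x : 0 < L -> 0 < x -> 0 <= bad1 eta L x.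
Proof. by move=> L0 x0; rewrite /bad1; case: ifP => // _; rewrite invr_ge0 mulr_ge0// ltW. Qed.

(** The first term of [bad] is distributed by [1 / (x y) = 1 / (x (x + y)) + 1 / ((x + y) y)]. If
    [x + y >= eta L], no new [bad1] appears and the numerators only decrease; otherwise they lose
    [x] and [y], which pays exactly for the two new terms [1 / (L (x + y))]. *)
Lemma bad_superadditive eta L x y : 0 < L -> 0 < x -> 0 < y ->
  bad eta L x (x + y) + bad eta L (x + y) y <= bad eta L x y.
Proof.
move=> L0 x0 y0; rewrite /bad.
set k1 := bad1 _ _ x; set k2 := bad1 _ _ y.
suff : Num.max 0 (2 * eta * L - x - (x + y)) / (L * x * (x + y)) +
   Num.max 0 (2 * eta * L - (x + y) - y) / (L * (x + y) * y) +
   2 * bad1 eta L (x + y) <=  Num.max 0 (2 * eta * L - x - y) / (L * x * y).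
  by lra.
have xy0 : 0 < x + y by rewrite addr_gt0.
set m := Num.max 0 (2 * eta * L - x - y).
have -> : m / (L * x * y) = m / (L * x * (x + y)) + m / (L * (x + y) * y).
  by field; rewrite !gt_eqF.
have [small|large] := ltP (x + y) (eta * L); last first.
  rewrite /bad1 ltNge large /= mulr0 addr0; apply: lerD; apply: ler_wpM2r;
    rewrite ?invr_ge0 ?mulr_ge0 ?(ltW L0) ?(ltW x0) ?(ltW y0) ?(ltW xy0)//;
    by rewrite ge_max !le_max lexx/=; apply/orP; right; lra.
rewrite /bad1 small /m !max_r; [|lra..].
rewrite le_eqVlt; apply/orP; left; apply/eqP.
by field; rewrite !gt_eqF.
Qed.

(** Descendants are followed until [x + y >= L]. There, either both coordinates lie in the band, or
    one is below [eta L] and [2 * bad] makes the left side nonpositive. Going back up, [f] and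
    [1 / (x y)] are additive and [bad] is superadditive. *)
Lemma lower_bound_from_band c f s eta L x y : 0 < c -> 0 < L -> 0 <= s ->
  0 < eta -> eta <= 2^-1 ->
  triangle_mass c f ->
  (forall x y, c <= x -> c <= y -> eta * L <= x <= L -> eta * L <= y <= L ->
     s / (x * y) <= f x y) ->
  c <= x <= L -> c <= y <= L ->
  s * ((x * y)^-1 - 2 * bad eta L x y) <= f x y.
Proof.
move=> c0 L0 s0 eta0 eta2 fP band /andP[cx xL] /andP[cy yL].
have gt0 z : c <= z -> 0 < z by exact: lt_le_trans.
have terminal u v : c <= u <= L -> c <= v <= L -> L <= u + v ->
    s * ((u * v)^-1 - 2 * bad eta L u v) <= f u v.
  move=> /andP[cu uL] /andP[cv vL] Luv.
  have [u0 v0] : 0 < u /\ 0 < v by split; apply: gt0.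
  have b0 : 0 <= Num.max 0 (2 * eta * L - u - v) / (L * u * v).
    by rewrite divr_ge0 ?le_max ?lexx// !mulr_ge0// ltW.
  have := bad1_ge0 eta L u L0 u0; have := bad1_ge0 eta L v L0 v0.
  have f0 := mass_ge0 _ _ fP _ _ cu cv.
  (* Since [w < eta L <= L / 2], the other coordinate [z] is at least [L / 2]. *)
  have key w z : 0 < w -> 0 < z -> w < eta * L -> L <= w + z ->
      (w * z)^-1 <= 2 * bad1 eta L w.
    move=> w0 z0 wL Lwz; rewrite /bad1 wL.
    have -> : 2 * (L * w)^-1 = (w * (L / 2))^-1 by field; rewrite !gt_eqF.
    have etaL : eta * L <= 2^-1 * L by rewrite ler_pM2r.
    by rewrite lef_pV2 ?posrE ?mulr_gt0 ?invr_gt0//; apply: ler_wpM2l; lra.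
  have [uS|uB] := ltP u (eta * L).
    move=> bv bu; apply: le_trans f0; rewrite mulr_ge0_le0//.
    have := key _ _ u0 v0 uS Luv; rewrite /bad; lra.
  have [vS|vB] := ltP v (eta * L).
    move=> bv bu; apply: le_trans f0; rewrite mulr_ge0_le0//.
    have := key _ _ v0 u0 vS; rewrite addrC (mulrC v) => /(_ Luv).
    rewrite /bad; lra.
  move=> bv bu; apply: le_trans (band _ _ cu cv _ _); rewrite ?uB ?vB//.
  by rewrite ler_wpM2l// /bad; lra.
(* Each move adds at least [c] to [x + y], which bounds the number of generations. *)
have [n] : exists n, L <= x + y + c *+ n.
  exists (Num.truncn (L / c)).+1.
  have : L / c < (Num.truncn (L / c)).+1%:R by apply: truncnS_gt.
  rewrite ltr_pdivrMr// mulr_natl => h.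
  by have := gt0 _ cx; have := gt0 _ cy; lra.
elim: n x y cx xL cy yL => [|n IH] x y cx xL cy yL.
  by rewrite mulr0n addr0 => ?; apply: terminal; rewrite ?cx ?cy.
have [x0 y0] : 0 < x /\ 0 < y by split; apply: gt0.
have [?|xyL] := leP L (x + y); first by move=> _; apply: terminal; rewrite ?cx ?cy.
rewrite mulrS => Ln.
rewrite (mass_additive _ _ fP _ _ cx cy).
apply: le_trans (lerD (IH x (x + y) _ _ _ _ _) (IH (x + y) y _ _ _ _ _)) => //; try lra.
rewrite -mulrDr ler_wpM2l//.
have := bad_superadditive eta L x y L0 x0 y0.
have -> : (x * y)^-1 = (x * (x + y))^-1 + ((x + y) * y)^-1.
  by field; rewrite !gt_eqF// addr_gt0.
lra.
Qed.

(** The crude bound [x y bad <= 2 eta + (x + y) / L] shows that the loss is small once [eta] is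
    small and [L] is large compared with [x + y]. *)
Lemma lower_bound_from_band_product c f s eta L x y : 0 < c -> 0 < L -> 0 <= s ->
  0 < eta -> eta <= 2^-1 ->
  triangle_mass c f ->
  (forall x y, c <= x -> c <= y -> eta * L <= x <= L -> eta * L <= y <= L ->
     s / (x * y) <= f x y) ->
  c <= x <= L -> c <= y <= L ->
  s * (1 - 4 * eta - 2 * (x + y) / L) <= x * y * f x y.
Proof.
move=> c0 L0 s0 eta0 eta2 fP band cxL cyL.
have x0 : 0 < x by apply: lt_le_trans c0 _; case/andP: cxL.
have y0 : 0 < y by apply: lt_le_trans c0 _; case/andP: cyL.
have xy0 : 0 < x * y by rewrite mulr_gt0.
have := lower_bound_from_band c f s eta L x y c0 L0 s0 eta0 eta2 fP band cxL cyL.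
rewrite -(ler_pM2l xy0); apply: le_trans.
rewrite mulrCA ler_wpM2l// mulrBr mulfV ?gt_eqF//.
have bad1_le z : 0 < z -> bad1 eta L z <= (L * z)^-1.
  by move=> z0; rewrite /bad1; case: ifP => // _; rewrite invr_ge0 mulr_ge0// ltW.
have bx := bad1_le _ x0; have by' := bad1_le _ y0.
suff : x * y * bad eta L x y <= 2 * eta + (x + y) / L.
  by rewrite -(mulrA 2 (x + y)) mulrCA; lra.
have -> : 2 * eta + (x + y) / L = x * y * ((2 * eta * L) / (L * x * y) + (L * x)^-1 + (L * y)^-1).
  by field; rewrite !gt_eqF.
rewrite ler_pM2l// /bad; apply: lerD => //; apply: lerD => //.
apply: ler_wpM2r; first by rewrite invr_ge0 !mulr_ge0// ltW.
by rewrite ge_max !mulr_ge0 ?ltW//=; lra.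
Qed.

Lemma invM_cone_additive c K f : 0 < c -> cone_additive c f ->
  cone_additive c (fun x y => K / (x * y) - f x y).
Proof.
move=> c0 fD x y cx cy; rewrite (fD _ _ cx cy).
have [x0 y0] : 0 < x /\ 0 < y by split; exact: lt_le_trans c0 _.
by field; rewrite !gt_eqF// addr_gt0.
Qed.

(** Supplies the limit hypothesis of [cone_additive_fan] for the defect: its first term is
    nonnegative and the triangle masses vanish along the fan. *)
Lemma invM_vanish c K f x y e : 0 < c -> 0 <= K -> triangle_mass c f ->
  c <= x -> c <= y -> 0 < e ->
  exists n, - e <= K / (x * (y + x *+ n.+1)) - f x (y + x *+ n.+1).
Proof.
move=> c0 K0 fP cx cy e0; have [n fe] := mass_vanishl _ _ fP _ _ _ cx cy e0.
have [x0 y0] : 0 < x /\ 0 < y by split; exact: lt_le_trans c0 _.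
exists n; have : 0 <= K / (x * (y + x *+ n.+1)) by
  rewrite divr_ge0// mulr_ge0 ?addr_ge0 ?mulrn_wge0// ltW.
lra.
Qed.

(** * Boundedness of [x y f x y] *)

(** By monotonicity [f >= f L L] on the band with [eta = 1/8], where [x y >= L ^ 2 / 64]; the band
    estimate at [(c, c)] keeps at least a quarter of this when [L > 16 c]. For smaller [L],
    monotonicity alone gives the same factor 256. *)
Lemma mass_diagonal_bound c f L : 0 < c -> triangle_mass c f -> c <= L ->
  L ^+ 2 * f L L <= 256 * (c ^+ 2 * f c c).
Proof.
move=> c0 fP cL; have L0 : 0 < L by exact: lt_le_trans cL.
have fL0 := mass_ge0 _ _ fP _ _ cL cL.
have [small|large] := leP L (16 * c).
  have -> : 256 * (c ^+ 2 * f c c) = (16 * c) ^+ 2 * f c c by ring.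
  apply: ler_pM => //; first by rewrite exprn_ge0// ltW.
    by rewrite ler_pXn2r// nnegrE ltW// mulr_gt0.
  exact: (mass_noninc _ _ fP).
have := lower_bound_from_band_product c f (f L L * L ^+ 2 / 64) 8^-1 L c c.
have s0 : 0 <= f L L * L ^+ 2 / 64 by rewrite divr_ge0// mulr_ge0// exprn_ge0// ltW.
move=> /(_ c0 L0 s0 ltac:(lra) ltac:(lra) fP) => H.
have : f L L * L ^+ 2 / 64 * (1 - 4 * 8^-1 - 2 * (c + c) / L) <= c * c * f c c.
  apply: H; rewrite ?lexx//= => x y cx cy /andP[x1 x2] /andP[y1 y2].
  have [x0 y0] : 0 < x /\ 0 < y by split; exact: lt_le_trans c0 _.
  apply: (@le_trans _ _ (f L L)); last exact: (mass_noninc _ _ fP).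
  rewrite ler_pdivrMr ?mulr_gt0// -mulrA ler_wpM2l//.
  have : (8^-1 * L) * (8^-1 * L) <= x * y by apply: ler_pM => //; rewrite mulr_ge0 ?invr_ge0// ltW.
  by rewrite expr2; lra.
have q : 4^-1 <= 1 - 4 * 8^-1 - 2 * (c + c) / L.
  have : 2 * (c + c) / L <= 4^-1 by rewrite ler_pdivrMr//; lra.
  by lra.
move=> H2.
have := ler_wpM2l s0 q => /le_trans/(_ H2).
by rewrite !expr2; lra.
Qed.

(** For [x <= y] the pairs of the fan have the form [(z + x, z)] with [x <= z], so the diagonal
    bound applies to them with a further factor 2. The defect is then nonnegative along the fan,
    hence at [(x, y)]. *)
Lemma mass_bound_le c f x y : 0 < c -> triangle_mass c f -> c <= x -> x <= y ->
  x * y * f x y <= 512 * (c ^+ 2 * f c c).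
Proof.
move=> c0 fP cx xy; have cy := le_trans cx xy.
have [x0 y0] : 0 < x /\ 0 < y by split; exact: lt_le_trans c0 _.
set K := 512 * _.
have K0 : 0 <= K.
  by rewrite mulr_ge0// mulr_ge0 ?exprn_ge0 ?(mass_ge0 _ _ fP)// ltW.
have E0 k : 0 <= K / ((y + x *+ k.+1) * (y + x *+ k)) - f (y + x *+ k.+1) (y + x *+ k).
  rewrite mulrSr addrA; set z := y + x *+ k.
  have xz : x <= z by rewrite ler_wpDr// mulrn_wge0// ltW.
  clearbody z; have z0 : 0 < z by exact: lt_le_trans xz.
  have cz : c <= z by exact: le_trans xz.
  have fzz := mass_diagonal_bound c f z c0 fP cz.
  have fz0 := mass_ge0 _ _ fP _ _ cz cz.
  rewrite subr_ge0 ler_pdivlMr ?mulr_gt0 ?addr_gt0//.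
  have fz : f (z + x) z <= f z z.
    by apply: (mass_noninc _ _ fP) => //; rewrite lerDl ltW.
  have zxz : (z + x) * z <= 2 * z ^+ 2 by rewrite expr2 mulrA ler_pM2r//; lra.
  apply: (@le_trans _ _ (f z z * (2 * z ^+ 2))).
    apply: ler_pM => //.
      by apply: (mass_ge0 _ _ fP) => //; rewrite ler_wpDr// ltW.
    by rewrite ltW// mulr_gt0 ?addr_gt0.
  by rewrite /K; lra.
have := cone_additive_fan c (fun x y => K / (x * y) - f x y) x y c0 cx cy
  (invM_cone_additive c K f c0 (mass_additive _ _ fP)) E0.
move=> /(_ (fun e => invM_vanish c K f x y e c0 K0 fP cx cy)) /=.
have := E0 0; rewrite mulr1n mulr0n addr0 (addrC y) => h /(le_trans h).
by rewrite subr_ge0 ler_pdivlMr ?mulr_gt0// mulrC.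
Qed.

Lemma mass_bound c f x y : 0 < c -> triangle_mass c f -> c <= x -> c <= y ->
  x * y * f x y <= 512 * (c ^+ 2 * f c c).
Proof.
move=> c0 fP cx cy; have [xy|/ltW yx] := leP x y; first exact: mass_bound_le.
by rewrite (mulrC x); exact: (mass_bound_le c _ y x c0 (triangle_mass_sym _ _ fP)).
Qed.

(** * Descent to balanced and distant pairs *)

(** If [K / (x y) - f x y] were positive at every pair of the fan, it would be positive at [(x, y)].
    The pairs of the fan are balanced within a factor 2, and their sum has grown by at least [c]. *)
Lemma mass_descend_le c K f x y : 0 < c -> 0 <= K -> triangle_mass c f ->
  c <= x -> x <= y -> K / (x * y) <= f x y ->
  exists x' y', [/\ c <= x', c <= y', x' <= 2 * y', y' <= 2 * x' & x + y + c <= x' + y'] /\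
    K / (x' * y') <= f x' y'.
Proof.
move=> c0 K0 fP cx xy Kf; have cy := le_trans cx xy.
have [x0 y0] : 0 < x /\ 0 < y by split; exact: lt_le_trans c0 _.
apply: contrapT => none.
have E0 k : 0 < K / ((y + x *+ k.+1) * (y + x *+ k)) - f (y + x *+ k.+1) (y + x *+ k).
  have : 0 <= x *+ k by rewrite mulrn_wge0// ltW.
  rewrite mulrSr; set u := _ *+ _ => u0.
  rewrite subr_gt0 ltNge; apply/negP => KE; apply: none.
  by exists (y + (u + x)), (y + u); split => //; split; lra.
have := cone_additive_fan c (fun x y => K / (x * y) - f x y) x y c0 cx cy
  (invM_cone_additive c K f c0 (mass_additive _ _ fP)) (fun k => ltW (E0 k)).
move=> /(_ (fun e => invM_vanish c K f x y e c0 K0 fP cx cy)) /=.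
have := E0 0; rewrite mulr1n mulr0n addr0 (addrC y) => h /(lt_le_trans h).
by rewrite subr_gt0 ltNge Kf.
Qed.

Lemma mass_descend c K f x y : 0 < c -> 0 <= K -> triangle_mass c f ->
  c <= x -> c <= y -> K / (x * y) <= f x y ->
  exists x' y', [/\ c <= x', c <= y', x' <= 2 * y', y' <= 2 * x' & x + y + c <= x' + y'] /\
    K / (x' * y') <= f x' y'.
Proof.
move=> c0 K0 fP cx cy; have [xy|/ltW yx] := leP x y; first exact: mass_descend_le.
rewrite (mulrC x) => /(mass_descend_le c K _ y x c0 K0 (triangle_mass_sym _ _ fP) cy yx).
move=> [x' [y' [[? ? ? ? ?] Kf]]]; exists y', x'; rewrite (mulrC y'); split => //.
by split; rewrite // (addrC x) (addrC y').
Qed.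

Lemma mass_descend_far c K f x y r : 0 < c -> 0 <= K -> triangle_mass c f ->
  c <= x -> c <= y -> K / (x * y) <= f x y ->
  exists x' y', [/\ c <= x', c <= y', x' <= 2 * y', y' <= 2 * x' & r <= x' + y'] /\
    K / (x' * y') <= f x' y'.
Proof.
move=> c0 K0 fP cx cy Kf.
suff [n [x' [y' [? ?]]]] : exists n : nat, exists x' y',
    [/\ c <= x', c <= y', x' <= 2 * y', y' <= 2 * x' & r <= x' + y'] /\
    K / (x' * y') <= f x' y' by exists x', y'.
have [n rn] : exists n, r <= c *+ n.
  exists (Num.truncn (r / c)).+1.
  have : r / c < (Num.truncn (r / c)).+1%:R by exact: truncnS_gt.
  by rewrite ltr_pdivrMr// mulr_natl => /ltW.
exists n.
have [x' [y' [[? ? ? ? ?] ?]]] : exists x' y',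
    [/\ c <= x', c <= y', x' <= 2 * y', y' <= 2 * x' & c *+ n <= x' + y'] /\
    K / (x' * y') <= f x' y'.
  elim: n {rn} => [|n [x' [y' [[cx' cy' _ _ nxy'] Kf']]]].
    have [x' [y' [[? ? ? ? ?] ?]]] := mass_descend c K f x y c0 K0 fP cx cy Kf.
    by exists x', y'; split => //; split => //; rewrite mulr0n; lra.
  have [u [v [[? ? ? ? ?] ?]]] := mass_descend c K f x' y' c0 K0 fP cx' cy' Kf'.
  by exists u, v; split => //; split => //; rewrite mulrSr; lra.
by exists x', y'; split => //; split => //; exact: le_trans rn _.
Qed.

(** The moves that lead from [(1, 1)] to [(A, B)] turn [(s, t)] into a pair whose coordinates are
    sums of [A] and of [B] terms, each equal to [s] or [t]. *)
Lemma coprime_descent c D (p q s t : R) A B : 0 < c -> cone_decreasing c D ->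
  (0 < A)%N -> (0 < B)%N -> coprime A B -> c <= p -> p <= s <= q -> p <= t <= q ->
  exists x y, [/\ p *+ A <= x <= q *+ A, p *+ B <= y <= q *+ B & D x y <= D s t].
Proof.
move=> c0 DD A0 B0 AB cp sI tI.
have p0 : 0 < p by exact: lt_le_trans cp.
have cpn n : (0 < n)%N -> c <= p *+ n.
  by case: n => // n _; rewrite mulrS ler_wpDr// mulrn_wge0// ltW.
apply: (coprime_ind (fun A B => exists x y,
  [/\ p *+ A <= x <= q *+ A, p *+ B <= y <= q *+ B & D x y <= D s t]) _ _ A B A0 B0 AB).
  by exists s, t.
move=> {A0 B0 AB} A' B' A0 B0 [x [y [/andP[x1 x2] /andP[y1 y2] Dxy]]].
have [cx cy] : c <= x /\ c <= y by split; [apply: le_trans x1|apply: le_trans y1]; exact: cpn.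
split; [exists x, (x + y)|exists (x + y), y]; split.
- by rewrite x1.
- by rewrite !mulrnDr !lerD.
- by apply: le_trans Dxy; exact: (DD _ _ cx cy).1.
- by rewrite !mulrnDr !lerD.
- by rewrite y1.
- by apply: le_trans Dxy; exact: (DD _ _ cx cy).2.
Qed.

(* Moving from [(x, y)] to [(x + j y, x + (j+1) y)] brings the two coordinates
   within a factor [1 + 1/j] of each other; a fixed finite family of coprime
   descents then reaches every direction, at every large scale. *)
Lemma descent_dense eta e : 0 < eta -> 0 < e -> exists2 M, 0 < M &
  forall c D L x y X Y, 0 < c -> cone_decreasing c D -> c <= x -> c <= y ->
  M * (x + y) <= L -> eta * L <= X <= L -> eta * L <= Y <= L ->
  exists x' y', [/\ X <= x' <= (1 + e) ^+ 2 * X,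
    Y <= y' <= (1 + e) ^+ 2 * Y & D x' y' <= D x y].
Proof.
move=> eta0 e0.
(* A denominator fine enough to approximate every ratio [X / Y >= eta] within a factor [1 + e]. *)
pose N := (Num.truncn (eta * e)^-1).+1.
have N0 : 0 < N%:R :> R by [].
have NE : 1 <= e * eta * N%:R.
  rewrite mulrC -ler_pdivrMr ?mulr_gt0// div1r (mulrC e).
  by apply: ltW; exact: truncnS_gt.
(* The two summands make [N (x + y)] small against [eta L] and [2 N (x + y)] small against
   [e eta L]. *)
exists (2 * N%:R / (e * eta) + N%:R / eta).
  by rewrite addr_gt0 ?divr_gt0 ?mulr_gt0.
move=> c D L x y X Y c0 DD cx cy ML /andP[X1 X2] /andP[Y1 Y2].
have [x0 y0] : 0 < x /\ 0 < y by split; exact: lt_le_trans c0 _.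
have etaL : 2 * N%:R * (x + y) + e * (N%:R * (x + y)) <= e * (eta * L).
  have := ler_wpM2l (ltW (mulr_gt0 e0 eta0)) ML; rewrite -(mulrA e eta L); congr (_ <= _).
  by field; rewrite !gt_eqF.
have NxL : N%:R * (x + y) <= eta * L.
  rewrite -(ler_pM2l e0); apply: le_trans etaL.
  by rewrite lerDr !mulr_ge0// addr_ge0// ltW.
have NyL : 2 * N%:R * (x + y) <= e * (eta * L).
  by apply: le_trans etaL; rewrite lerDl !mulr_ge0 ?ltW// addr_gt0.
have NX : 0 < N%:R * (x + y) by rewrite mulr_gt0// addr_gt0.
have [X0 Y0] : 0 < X /\ 0 < Y by split; lra.
(* [A0 / N] approximates [X / Y] from above; its reduced form [A / B] selects the coprime
   descent. *)
pose A0 := (Num.truncn (N%:R * X / Y)).+1.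
have A0lo : N%:R * X <= A0%:R * Y.
  by rewrite -ler_pdivrMr//; apply: ltW; exact: truncnS_gt.
have A0hi : A0%:R * Y <= (1 + e) * (N%:R * X).
  have q0 : 0 <= N%:R * X / Y by rewrite !mulr_ge0 ?invr_ge0 ?ltW.
  have : A0%:R <= N%:R * X / Y + 1 by rewrite /A0 -natr1 lerD2r truncn_le.
  move=> /(ler_wpM2r (ltW Y0)); rewrite mulrDl mul1r divfK ?gt_eqF// => h.
  apply: le_trans h _; rewrite mulrDl mul1r lerD2l; apply: (le_trans Y2).
  have L0 : 0 < L by lra.
  have := ler_wpM2r (ltW L0) NE; rewrite mul1r => h.
  apply: le_trans h _; rewrite -!mulrA ler_pM2l// mulrCA ler_pM2l//.
pose g := gcdn A0 N; pose A := (A0 %/ g)%N; pose B := (N %/ g)%N.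
have g0 : (0 < g)%N by rewrite gcdn_gt0.
have A0E : A0 = (A * g)%N by rewrite divnK// dvdn_gcdl.
have N_E : N = (B * g)%N by rewrite divnK// dvdn_gcdr.
have Ap : (0 < A)%N by move: (isT : (0 < A0)%N); rewrite A0E muln_gt0 => /andP[].
have Bp : (0 < B)%N by move: (isT : (0 < N)%N); rewrite N_E muln_gt0 => /andP[].
have cAB : coprime A B.
  by rewrite /coprime -(eqn_pmul2r g0) muln_gcdl -A0E -N_E mul1n.
have gR : 0 < g%:R :> R by rewrite ltr0n.
have [Ar Br] : 0 < A%:R :> R /\ 0 < B%:R :> R by rewrite !ltr0n.
have Alo : B%:R * X <= A%:R * Y.
  by rewrite -(ler_pM2r gR) mulrAC -natrM -N_E (mulrAC _ Y) -natrM -A0E.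
have Ahi : A%:R * Y <= (1 + e) * (B%:R * X).
  rewrite -(ler_pM2r gR) (mulrAC _ Y) -natrM -A0E -mulrA (mulrAC _ X).
  by rewrite -natrM -N_E.
have BN : B%:R <= N%:R :> R by rewrite ler_nat N_E leq_pmulr.
have YB : x <= Y / B%:R.
  rewrite ler_pdivlMr//; apply: le_trans Y1; apply: le_trans NxL.
  by rewrite mulrC; apply: ler_pM => //; rewrite ?ltW// ltr_pwDr.
(* The first [j] found for which [B] copies of [x + j y] reach [Y]; the overshoot of each copy is at
   most [y]. *)
pose j := (Num.truncn ((Y / B%:R - x) / y)).+1.
have jlo : Y / B%:R <= x + y *+ j.
  rewrite -lerBlDl -[y *+ j]mulr_natl -ler_pdivrMr//; apply: ltW; exact: truncnS_gt.
have jhi : x + y *+ j <= Y / B%:R + y.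
  rewrite mulrSr addrA lerD2r -lerBrDl -[y *+ _]mulr_natl -ler_pdivlMr// truncn_le//.
  by rewrite divr_ge0 ?subr_ge0// ltW.
clearbody j; have cxj k : c <= x + y *+ k by rewrite ler_wpDr// mulrn_wge0// ltW.
have Dj k : D (x + y *+ k) y <= D x y.
  elim: k => [|k IH]; first by rewrite mulr0n addr0.
  by apply: le_trans IH; rewrite mulrSr addrA; exact: (DD _ _ (cxj k) cy).2.
have := coprime_descent c D (x + y *+ j) (x + y *+ j.+1) (x + y *+ j) (x + y *+ j.+1)
  A B c0 DD Ap Bp cAB (cxj j).
have jj : x + y *+ j <= x + y *+ j.+1 by rewrite lerD2l mulrSr lerDl ltW.
rewrite jj !lexx /= => /(_ isT isT) [x' [y' [/andP[x1 x2] /andP[y1 y2] Dxy]]].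
(* The total overshoot [2 B y] is at most [2 N (x + y) <= e Y]. *)
have Phi : B%:R * (x + y *+ j.+1) <= (1 + e) * Y.
  rewrite mulrSr addrA.
  apply: le_trans (ler_wpM2l (ltW Br) (lerD jhi (lexx y))) _.
  rewrite !mulrDr mulrCA mulfV ?gt_eqF// mulr1 mulrDl mul1r.
  have : B%:R * y <= N%:R * (x + y).
    by apply: ler_pM => //; rewrite ?ltW// ltr_pwDl.
  have : e * (eta * L) <= e * Y by rewrite ler_pM2l.
  lra.
exists x', y'; split.
- apply/andP; split.
    apply: le_trans x1; rewrite -[_ *+ A]mulr_natl.
    apply: le_trans (ler_wpM2l (ltW Ar) jlo).
    by rewrite mulrA ler_pdivlMr// mulrC.
  apply: le_trans x2 _; rewrite -[_ *+ A]mulr_natl -(ler_pM2l Br) mulrCA.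
  apply: le_trans (ler_wpM2l (ltW Ar) Phi) _.
  have -> : B%:R * ((1 + e) ^+ 2 * X) = (1 + e) * ((1 + e) * (B%:R * X)) by ring.
  by rewrite mulrCA ler_pM2l ?addr_gt0.
- apply/andP; split.
    apply: le_trans y1; rewrite -[_ *+ B]mulr_natl.
    apply: le_trans (ler_wpM2l (ltW Br) jlo).
    by rewrite mulrCA mulfV ?mulr1// gt_eqF.
  apply: le_trans y2 _; rewrite -[_ *+ B]mulr_natl; apply: le_trans Phi _.
  by rewrite ler_pM2r// expr2 ler_pMl ?addr_gt0//; lra.
- apply: le_trans Dxy _; apply: le_trans (Dj j).
  by rewrite mulrSr addrA; exact: (DD _ _ (cxj j) cy).1.
Qed.

(** * Rigidity of triangle masses *)

(** [S] is the supremum of [x y f x y]. A nearly extremal pair [(u, v)], balanced and distant, has a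
    small defect; [descent_dense] spreads it over a band at scale [L = M (u + v)], and the band
    estimate brings the resulting lower bound back to [(x, y)]. *)
Lemma triangle_mass_eq c f : 0 < c -> triangle_mass c f ->
  exists2 S, 0 <= S & forall x y, c <= x -> c <= y -> f x y = S / (x * y).
Proof.
move=> c0 fP.
pose V := [set v | exists x y, [/\ c <= x, c <= y & v = x * y * f x y]].
have supV : has_sup V.
  split; first by exists (c * c * f c c), c, c.
  by exists (512 * (c ^+ 2 * f c c)) => _ [x [y [cx cy ->]]]; exact: mass_bound.
pose S := sup V.
have gt0 z : c <= z -> 0 < z by exact: lt_le_trans.
have V0 v : V v -> 0 <= v.
  move=> [x [y [cx cy ->]]]; rewrite mulr_ge0 ?(mass_ge0 _ _ fP)//.
  by rewrite mulr_ge0// ltW// gt0.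
have leS x y : c <= x -> c <= y -> x * y * f x y <= S.
  by move=> cx cy; apply: ub_le_sup; [exact: supV.2|exists x, y].
have S0 : 0 <= S.
  apply: le_trans (leS _ _ (lexx c) (lexx c)).
  by rewrite mulr_ge0 ?(mass_ge0 _ _ fP)// mulr_ge0// ltW.
pose D x y := S / (x * y) - f x y.
have D0 x y : c <= x -> c <= y -> 0 <= D x y.
  move=> cx cy; rewrite subr_ge0 ler_pdivlMr ?mulr_gt0 ?gt0// mulrC.
  exact: leS.
have DD : cone_decreasing c D.
  have Dadd := invM_cone_additive c S f c0 (mass_additive _ _ fP).
  move=> x y cx cy; rewrite {2 4}/D (Dadd _ _ cx cy) -/(D x (x + y)) -/(D (x + y) y).
  by rewrite lerDl lerDr !D0// ler_wpDr// ltW// gt0.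
exists S => // x y cx cy.
have [x0 y0] := (gt0 _ cx, gt0 _ cy).
apply/eqP; rewrite eq_le ler_pdivlMr ?mulr_gt0// mulrC leS//=.
rewrite ler_pdivrMr ?mulr_gt0// mulrC.
(* The error budget: [4 e S] for the approximation of points of the band, [5 e S] for the mass
   missing the band, [e] for the defect; products of errors have a favourable sign. *)
suff main e : 0 < e -> e <= 8^-1 -> S <= x * y * f x y + e * (9 * S + 1).
  apply/ler_addgt0Pr => d d0.
  have S9 : 0 < 9 * S + 1 by lra.
  pose e := Num.min 8^-1 (d / (9 * S + 1)).
  have e0 : 0 < e by rewrite lt_min invr_gt0 ltr0n divr_gt0.
  apply: le_trans (main e e0 _) _; first by rewrite ge_min lexx.
  by rewrite lerD2l -ler_pdivlMr// ge_min lexx orbT.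
move=> e0 e8.
have [M M0 dense] := descent_dense e e e0 e0.
(* [t] absorbs the factor [(1 + e) ^ 4] between [x' y'] and [X Y]. *)
pose t := 1 - 4 * e.
have t1 : t * ((1 + e) ^+ 2 * (1 + e) ^+ 2) <= 1.
  rewrite /t -subr_ge0; have -> : 1 - (1 - 4 * e) * ((1 + e) ^+ 2 * (1 + e) ^+ 2) =
    e ^+ 2 * (10 + 20 * e + 15 * e ^+ 2 + 4 * e ^+ 3) by ring.
  by rewrite mulr_ge0 ?exprn_ge0 ?addr_ge0 ?mulr_ge0 ?exprn_ge0 ?(ltW e0).
(* A defect [d / (u v)], multiplied by [X Y <= L ^ 2], is then at most [e] for balanced [u] and
   [v]. *)
pose d := e / (5 * M ^+ 2).
have d0 : 0 < d by rewrite divr_gt0// mulr_gt0// exprn_gt0.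
pose K := Num.max 0 (S - d).
have K0 : 0 <= K by rewrite le_max lexx.
have [u0 [v0 [cu0 cv0 Kf0]]] : exists u v, [/\ c <= u, c <= v & K / (u * v) <= f u v].
  have [_ [u [v [cu cv ->]]] near] := sup_adherent d0 supV.
  exists u, v; split => //; rewrite ler_pdivrMr ?mulr_gt0 ?gt0// mulrC ge_max.
  by rewrite (ltW near) andbT; apply: V0; exists u, v.
(* The required distance ensures [2 (x + y) / L <= e] and places [x] and [y] below [L]. *)
have [u [v [[cu cv uv vu far] Kf]]] :=
  mass_descend_far c K f u0 v0 (2 * (x + y) / (e * M) + (x + y) / M) c0 K0 fP cu0 cv0 Kf0.
have [u00 v00] := (gt0 _ cu, gt0 _ cv).
pose L := M * (u + v).
have Lfar : 2 * (x + y) / e + (x + y) <= L.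
  rewrite /L [leRHS]mulrC -ler_pdivrMr//; apply: le_trans far.
  by rewrite le_eqVlt; apply/orP; left; apply/eqP; field; rewrite !gt_eqF.
have xye : 0 < 2 * (x + y) / e by rewrite divr_gt0// mulr_gt0// addr_gt0.
have L0 : 0 < L by rewrite mulr_gt0// addr_gt0.
have Duv : D u v <= d / (u * v).
  rewrite /D lerBlDl -lerBlDr -mulrBl; apply: le_trans Kf.
  by rewrite ler_pM2r ?invr_gt0 ?mulr_gt0// le_max lexx orbT.
(* Balance enters here: [(2 v - u) (2 u - v) >= 0] bounds [u ^ 2 + v ^ 2] by [5/2 u v]. *)
have uv5 : (u + v) ^+ 2 <= 5 * (u * v).
  have : 0 <= (2 * v - u) * (2 * u - v) by rewrite mulr_ge0// subr_ge0.
  have : 0 <= u * v by rewrite mulr_ge0// ltW.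
  by rewrite expr2; lra.
pose s := Num.max 0 (t * S - e).
have s0 : 0 <= s by rewrite le_max lexx.
have band X Y : c <= X -> c <= Y -> e * L <= X <= L -> e * L <= Y <= L ->
    s / (X * Y) <= f X Y.
  move=> cX cY XL YL; have [X0 Y0] := (gt0 _ cX, gt0 _ cY).
  have [x' [y' [/andP[x1 x2] /andP[y1 y2] Dxy]]] :=
    dense c D L u v X Y c0 DD cu cv (lexx _) XL YL.
  have [x'0 y'0] : 0 < x' /\ 0 < y' by split; [exact: lt_le_trans x1|exact: lt_le_trans y1].
  rewrite ler_pdivrMr ?mulr_gt0// /s ge_max mulr_ge0 ?(mass_ge0 _ _ fP)//=; last first.
    by rewrite mulr_ge0 ?ltW.
  have fle := mass_noninc _ _ fP _ _ _ _ cX cY x1 y1.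
  rewrite -ler_pdivrMr ?mulr_gt0//; apply: le_trans fle.
  have : S / (x' * y') - d / (u * v) <= f x' y'.
    by rewrite lerBlDl -lerBlDr; exact: le_trans Dxy Duv.
  apply: le_trans; rewrite mulrBl; apply: lerB.
    rewrite ler_pdivrMr ?mulr_gt0// mulrAC ler_pdivlMr ?mulr_gt0//.
    rewrite [leLHS]mulrAC [leLHS]mulrC ler_wpM2l//.
    have xy' : x' * y' <= ((1 + e) ^+ 2 * X) * ((1 + e) ^+ 2 * Y).
      by apply: ler_pM => //; exact: ltW.
    apply: (@le_trans _ _ (t * (((1 + e) ^+ 2 * X) * ((1 + e) ^+ 2 * Y)))).
      by rewrite ler_wpM2l// /t; lra.
    have := ler_wpM2r (ltW (mulr_gt0 X0 Y0)) t1; rewrite mul1r; congr (_ <= _).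
    by ring.
  rewrite ler_pdivrMr ?mulr_gt0// mulrAC ler_pdivlMr ?mulr_gt0//.
  have XYL : X * Y <= L * L.
    by move: XL YL => /andP[_ ?] /andP[_ ?]; apply: ler_pM => //; exact: ltW.
  apply: (le_trans (ler_wpM2l (ltW d0) XYL)).
  have -> : d * (L * L) = e / 5 * (u + v) ^+ 2.
    by rewrite /d /L; field; rewrite gt_eqF.
  have := ler_wpM2l (ltW e0) uv5; lra.
have xL : x <= L by lra.
have yL : y <= L by lra.
have e2 : e <= 2^-1 by lra.
have := lower_bound_from_band_product c f s e L x y c0 L0 s0 e0 e2 fP band.
rewrite cx cy xL yL => /(_ isT isT) low.
have eL : 2 * (x + y) / L <= e.
  rewrite ler_pdivrMr// [leRHS]mulrC -ler_pdivrMr//; lra.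
have : s * (1 - 5 * e) <= x * y * f x y.
  by apply: le_trans low; rewrite ler_wpM2l//; lra.
have : (t * S - e) * (1 - 5 * e) <= s * (1 - 5 * e).
  by rewrite ler_wpM2r ?le_max ?lexx ?orbT//; lra.
have : 0 <= e * e * S by rewrite !mulr_ge0// ltW.
have : 0 <= e * e by rewrite mulr_ge0// ltW.
rewrite /t; lra.
Qed.

End cone_additive.

(** * Measure theory *)

(** Packages the image under [f] of [m] restricted to [D] as a measure, so that uniqueness theorems
    apply to it. *)
Lemma restricted_image_measure d d' (T1 : measurableType d) (T2 : measurableType d')
    (R : realType) (m : {measure set T1 -> \bar R}) (f : T1 -> T2) (D : set T1) :
  measurable_fun setT f -> measurable D ->
  exists m' : {measure set T2 -> \bar R}, forall A, m' A = m (f @^-1` A `&` D).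
Proof.
move=> mf mD; eexists (pushforward (mrestr m mD) f); reflexivity.
Unshelve. exact: mf.
Qed.

Section rational_rays.
Context {R : realType}.

(** Rational endpoints suit the later comparison, which reaches only sectors of rational slope. *)
Definition rational_rays : set (set R) :=
  [set `]-oo, ratr q]%classic | q in [set: rat]].

Lemma measurable_rational_rays :
  (measurable : set (set R)) = <<s rational_rays >>.
Proof.
rewrite eqEsubset; split => A; last first.
  apply: smallest_sub; first exact: sigma_algebra_measurable.
  by move=> _ [q _ <-]; exact: measurable_itv.
move=> mA; have : (@measurable_realfun.RGenOInfty.G R).-sigma.-measurable A.
  by rewrite -measurable_realfun.RGenOInfty.measurableE.
apply: smallest_sub; first exact: smallest_sigma_algebra.
move=> _ [x ->].
have -> : `]x, +oo[%classic =
    \bigcup_(q : rat) (if x < ratr q then ~` `]-oo, ratr q]%classic else set0) :> set R.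
  apply/seteqP; split=> [y|y [q _]] /=.
    rewrite in_itv/= andbT => xy; have [q] := rat_in_itvoo xy.
    rewrite in_itv/= => /andP[xq qy]; exists q => //.
    by rewrite xq /= in_itv/=; apply/negP; rewrite -ltNge.
  case: ifPn => // xq; rewrite /= !in_itv/= andbT => /negP; rewrite -ltNge.
  exact: lt_trans.
apply: (@bigcupT_measurable_rat _ (g_sigma_algebraType rational_rays)) => q.
case: ifPn => // _; apply: measurableC; apply: sub_sigma_algebra.
by exists q.
Qed.

Lemma measure_unique_rays (m1 m2 : {measure set R -> \bar R}) :
  (m1 setT < +oo)%E ->
  (forall q, m1 `]-oo, ratr q]%classic = m2 `]-oo, ratr q]%classic) ->
  forall A, measurable A -> m1 A = m2 A.
Proof.
move=> m1oo m12; apply: (measure_unique rational_rays (fun n => `]-oo, ratr n%:R]%classic)).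
- exact: measurable_rational_rays.
- move=> _ _ [p _ <-] [q _ <-]; exists (Order.min p q) => //.
  have [pq|/ltW qp] := leP p q.
    rewrite setIidl// => x /=; rewrite !in_itv/= => /le_trans; apply.
    by rewrite ler_rat.
  rewrite setIidr// => x /=; rewrite !in_itv/= => /le_trans; apply.
  by rewrite ler_rat.
- by move=> i; exists i%:R.
- apply/seteqP; split=> x // _; exists (Num.truncn `|x|).+1 => //=.
  rewrite in_itv/= ratr_nat (le_trans (ler_norm _))// ltW//; exact: truncnS_gt.
- by move=> _ [q _ <-].
- move=> n; apply: le_lt_trans m1oo; apply: le_measure => //; rewrite inE//.
Qed.

(** One coordinate at a time: uniqueness on the line, applied to the image of a slab, frees the
    first factor and then the second; rectangles are stable under intersection and generate. *)
Lemma measure_unique_quadrants (m1 m2 : {measure set (R * R) -> \bar R}) :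
  (m1 setT < +oo)%E ->
  (forall p q, m1 (`]-oo, ratr p]%classic `*` `]-oo, ratr q]%classic) =
               m2 (`]-oo, ratr p]%classic `*` `]-oo, ratr q]%classic)) ->
  forall A, measurable A -> m1 A = m2 A.
Proof.
move=> m1oo m12.
have m1fin (B : set (R * R)) : measurable B -> (m1 B < +oo)%E.
  by move=> mB; apply: le_lt_trans m1oo; apply: le_measure => //; rewrite inE.
have mfst : measurable_fun [set: R * R] (@fst R R) := measurable_fst.
have msnd : measurable_fun [set: R * R] (@snd R R) := measurable_snd.
have slab (f : R * R -> R) D (mf : measurable_fun setT f) (mD : measurable D) :
    (forall q, m1 (f @^-1` `]-oo, ratr q]%classic `&` D) =
               m2 (f @^-1` `]-oo, ratr q]%classic `&` D)) ->
    forall A, measurable A -> m1 (f @^-1` A `&` D) = m2 (f @^-1` A `&` D).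
  have [m1' m1'E] := restricted_image_measure _ _ _ _ _ m1 f D mf mD.
  have [m2' m2'E] := restricted_image_measure _ _ _ _ _ m2 f D mf mD.
  move=> H A mA; rewrite -m1'E -m2'E; apply: measure_unique_rays => //.
  - by rewrite m1'E preimage_setT setTI; exact: m1fin.
  - by move=> q; rewrite m1'E m2'E.
have fstE (A B : set R) : A `*` B = fst @^-1` A `&` ([set: R] `*` B).
  by apply/seteqP; split=> -[x y] /=; tauto.
have sndE (A B : set R) : A `*` B = snd @^-1` B `&` (A `*` [set: R]).
  by apply/seteqP; split=> -[x y] /=; tauto.
have step1 A q : measurable A -> m1 (A `*` `]-oo, ratr q]%classic) =
    m2 (A `*` `]-oo, ratr q]%classic).
  move=> mA; rewrite fstE; apply: slab => //; first exact: measurableX.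
  by move=> p; rewrite -fstE.
have step2 A B : measurable A -> measurable B -> m1 (A `*` B) = m2 (A `*` B).
  move=> mA mB; rewrite sndE; apply: slab => //; first exact: measurableX.
  by move=> p; rewrite -sndE step1.
apply: (measure_unique [set A `*` B | A in measurable & B in measurable] (fun=> setT)).
- exact: measurable_prod_measurableType.
- move=> _ _ [X1 mX1 [X2 mX2 <-]] [Y1 mY1 [Y2 mY2 <-]]; rewrite -setXI.
  exists (X1 `&` Y1); first exact: measurableI.
  by exists (X2 `&` Y2) => //; exact: measurableI.
- by move=> _; exists setT => //; exists setT => //; rewrite setXTT.
- by rewrite bigcup_const.
- by move=> _ [X1 mX1 [X2 mX2 <-]]; exact: step2.
- by move=> _.
Qed.

End rational_rays.

(** * Invariant measures of the quadrant *)

Section plane_measurability.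
Context {R : realType}.

Lemma measurable_le_set (f g : R * R -> R) :
  measurable_fun setT f -> measurable_fun setT g -> measurable [set p | f p <= g p].
Proof.
move=> mf mg.
have -> : [set p | f p <= g p] = setT `&` (fun p => g p - f p) @^-1` `[0, +oo[%classic.
  by apply/seteqP; split=> p /=; rewrite in_itv/= andbT subr_ge0 => // -[].
by apply: measurable_funB => //; exact: measurable_itv.
Qed.

Lemma measurable_comp_fst (f : R -> R) :
  continuous f -> measurable_fun setT (fun p : R * R => f p.1).
Proof.
move=> cf; apply: (@measurableT_comp _ _ _ _ _ _ f) => //.
exact: continuous_measurable_fun.
Qed.

Lemma measurable_comp_snd (f : R -> R) :
  continuous f -> measurable_fun setT (fun p : R * R => f p.2).
Proof.
move=> cf; apply: (@measurableT_comp _ _ _ _ _ _ f) => //.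
exact: continuous_measurable_fun.
Qed.

Lemma measurable_quadrant : measurable (@quadrant R).
Proof.
have -> : @quadrant R = `[0, +oo[%classic `*` `[0, +oo[%classic.
  by apply/seteqP; split=> p /=; rewrite !in_itv/= !andbT.
by apply: measurableX; exact: measurable_itv.
Qed.
End plane_measurability.

Section invariant_measures.
Context {R : realType} {sigma sigmainv : R -> R}.
Context (sigmaK : cancel sigma sigmainv) (sigmainvK : cancel sigmainv sigma).
Context (sigma_cont : continuous sigma) (sigmainv_cont : continuous sigmainv).
Context (sigma_incr : forall x y : R, x < y -> sigma x < sigma y).
Context (sigma_0 : sigma 0 = 0).
Local Notation Q := (@quadrant R).
Local Notation h := (hmap sigmainv).
Local Notation v := (vmap sigma).

(** The normalization is left out so that the property is stable under scaling. *)
Definition quadrant_invariant (m : set (R * R) -> \bar R) :=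
  [/\ m ([set 0] `*` [set y | 0 <= y]) = 0%E,
      m ([set x | 0 <= x] `*` [set 0]) = 0%E &
      forall A, measurable A -> A `<=` Q -> m A = m (h @` A) /\ m A = m (v @` A)].

Lemma sigma_mono : {mono sigma : x y / x <= y}.
Proof. by apply: le_mono => x y; exact: sigma_incr. Qed.

Lemma sigmainv_le x y : (sigmainv y <= x) = (y <= sigma x).
Proof. by rewrite -sigma_mono sigmainvK. Qed.

Lemma sigmainv_ge x y : (x <= sigmainv y) = (sigma x <= y).
Proof. by rewrite -sigma_mono sigmainvK. Qed.

Lemma sigma_ge0 x : 0 <= x -> 0 <= sigma x.
Proof. by rewrite -{2}sigma_0 sigma_mono. Qed.

Definition hinv (p : R * R) : R * R := (p.1 - sigmainv p.2, p.2).
Definition vinv (p : R * R) : R * R := (p.1, p.2 - sigma p.1).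

Lemma measurable_hmap : measurable_fun setT h.
Proof.
apply: measurable_fun_pair => //; apply: measurable_funD => //.
exact: measurable_comp_snd.
Qed.

Lemma measurable_vmap : measurable_fun setT v.
Proof.
apply: measurable_fun_pair => //; apply: measurable_funD => //.
exact: measurable_comp_fst.
Qed.

Lemma measurable_hinv : measurable_fun setT hinv.
Proof.
apply: measurable_fun_pair => //; apply: measurable_funB => //.
exact: measurable_comp_snd.
Qed.

Lemma measurable_vinv : measurable_fun setT vinv.
Proof.
apply: measurable_fun_pair => //; apply: measurable_funB => //.
exact: measurable_comp_fst.
Qed.

Lemma measurable_hsector : measurable [set p : R * R | sigmainv p.2 <= p.1].
Proof. by apply: measurable_le_set => //; exact: measurable_comp_snd. Qed.

Lemma measurable_vsector : measurable [set p : R * R | sigma p.1 <= p.2].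
Proof. by apply: measurable_le_set => //; exact: measurable_comp_fst. Qed.

Lemma measurable_preimageT (f : R * R -> R * R) B :
  measurable_fun setT f -> measurable B -> measurable (f @^-1` B).
Proof. by move=> mf mB; rewrite -[X in measurable X]setTI; exact: mf. Qed.

Lemma measurable_pull (f : R * R -> R * R) B : measurable_fun setT f -> measurable B ->
  measurable (Q `&` f @^-1` B).
Proof.
by move=> mf mB; apply: measurableI; [exact: measurable_quadrant|exact: measurable_preimageT].
Qed.

(** [h] is a bijection of the whole plane; as a preimage, the image of a Borel set is visibly
    Borel. *)
Lemma image_hmap A : h @` A = hinv @^-1` A.
Proof.
apply/seteqP; split=> [_ [[x y] Axy <-]|[x y] Axy] /=.
  by rewrite /hinv/= addrK.
by exists (hinv (x, y)) => //; rewrite /hmap/= subrK.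
Qed.

Lemma image_vmap A : v @` A = vinv @^-1` A.
Proof.
apply/seteqP; split=> [_ [[x y] Axy <-]|[x y] Axy] /=.
  by rewrite /vinv/= addrC addKr.
by exists (vinv (x, y)) => //; rewrite /vmap/= addrC subrK.
Qed.

Lemma image_pull_hmap B : B `<=` Q ->
  h @` (Q `&` h @^-1` B) = B `&` [set p | sigmainv p.2 <= p.1].
Proof.
move=> BQ; rewrite image_hmap; apply/seteqP; split=> -[x y] /=.
  by rewrite /hinv /hmap/= subrK => -[[/= xy y0] Bxy]; rewrite -subr_ge0.
rewrite /hinv /hmap/= subrK => -[Bxy xy]; split => //.
by split; rewrite /= ?subr_ge0//; exact: (BQ _ Bxy).2.
Qed.

Lemma image_pull_vmap B : B `<=` Q ->
  v @` (Q `&` v @^-1` B) = B `&` [set p | sigma p.1 <= p.2].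
Proof.
move=> BQ; rewrite image_vmap; apply/seteqP; split=> -[x y] /=.
  by rewrite /vinv /vmap/= subrKC => -[[/= xy y0] Bxy]; rewrite -subr_ge0.
rewrite /vinv /vmap/= subrKC => -[Bxy xy]; split => //.
by split; rewrite /= ?subr_ge0//; exact: (BQ _ Bxy).1.
Qed.

Lemma measurable_axes : measurable ([set 0 : R] `*` [set y : R | 0 <= y]) /\
  measurable ([set x : R | 0 <= x] `*` [set 0 : R]).
Proof.
have -> : [set y : R | 0 <= y] = `[0, +oo[%classic.
  by apply/seteqP; split=> y /=; rewrite in_itv/= andbT.
by split; apply: measurableX => //; exact: measurable_itv.
Qed.

(** The images of the quadrant under [h] and [v] are the two sides of the graph of [sigma]. They
    cover the quadrant and meet along that graph, which is null as the image under [h] of the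
    vertical half-axis. *)
Lemma invariant_split (m : {measure set (R * R) -> \bar R}) B :
  quadrant_invariant m -> measurable B -> B `<=` Q ->
  m B = (m (Q `&` h @^-1` B) + m (Q `&` v @^-1` B))%E.
Proof.
move=> [m0l m0b minv] mB BQ.
have [mhB mvB] := (measurable_pull h B measurable_hmap mB, measurable_pull v B measurable_vmap mB).
have QI f : Q `&` f @^-1` B `<=` Q by exact: subIsetl.
rewrite (minv _ mhB (QI _)).1 (minv _ mvB (QI _)).2 image_pull_hmap// image_pull_vmap//.
have diag0 : m (B `&` [set p | sigma p.1 <= p.2] `&` [set p | sigmainv p.2 <= p.1]) = 0%E.
  apply: (@subset_measure0 _ _ _ m _ (h @` ([set 0] `*` [set y | 0 <= y]))).
  - apply: measurableI; last exact: measurable_hsector.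
    by apply: measurableI => //; exact: measurable_vsector.
  - rewrite image_hmap; apply: measurable_preimageT; first exact: measurable_hinv.
    exact: measurable_axes.1.
  - move=> [x y] /= [[/BQ[/= _ y0]]]; rewrite -sigmainv_ge => xy yx.
    exists (0, y) => //; rewrite /hmap/= add0r; congr (_, _).
    by apply/eqP; rewrite eq_le yx xy.
  - apply: etrans (esym (minv _ measurable_axes.1 _).1) m0l => -[x y] /= [-> ?].
    by split.
rewrite [LHS](@measureDI _ _ _ m _ [set p | sigmainv p.2 <= p.1])//; last exact: measurable_hsector.
rewrite addeC; congr (_ + _)%E.
have mBV : measurable (B `&` [set p | sigma p.1 <= p.2]).
  by apply: measurableI => //; exact: measurable_vsector.
rewrite [RHS](@measureDI _ _ _ m _ [set p | sigmainv p.2 <= p.1])//; last exact: measurable_hsector.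
rewrite [X in (_ + X)%E](_ : _ = 0%E)// adde0; congr (m _).
apply/seteqP; split=> -[x y] /= [Bxy yx]; last by split => //; case: Bxy.
split=> //; split=> //; rewrite -sigmainv_ge leNgt; apply/negP => /ltW.
by rewrite -/(is_true _).
Qed.

Lemma invariant_axis_bottom0 (m : {measure set (R * R) -> \bar R}) B :
  quadrant_invariant m -> measurable B ->
  (forall p, B p -> Q p /\ p.2 <= 0) -> m B = 0%E.
Proof.
move=> [_ m0 _] mB BE; apply: subset_measure0 m0 => //; first exact: measurable_axes.2.
move=> [u w] /BE[[/= u0 w0] w0']; split=> //=.
by apply/eqP; rewrite eq_le w0 w0'.
Qed.

Lemma invariant_axis_left0 (m : {measure set (R * R) -> \bar R}) B :
  quadrant_invariant m -> measurable B ->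
  (forall p, B p -> Q p /\ p.1 <= 0) -> m B = 0%E.
Proof.
move=> [m0 _ _] mB BE; apply: subset_measure0 m0 => //; first exact: measurable_axes.1.
move=> [u w] /BE[[/= u0 w0] u0']; split=> //=.
by apply/eqP; rewrite eq_le u0 u0'.
Qed.

Lemma measurable_right_half : measurable [set p : R * R | 0 < p.1].
Proof.
have -> : [set p : R * R | 0 < p.1] = ~` [set p | p.1 <= 0].
  by apply/seteqP; split=> p /=; rewrite ltNge => /negP.
by apply: measurableC; exact: measurable_le_set.
Qed.

Lemma measurable_upper_half : measurable [set p : R * R | 0 < p.2].
Proof.
have -> : [set p : R * R | 0 < p.2] = ~` [set p | p.2 <= 0].
  by apply/seteqP; split=> p /=; rewrite ltNge => /negP.
by apply: measurableC; exact: measurable_le_set.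
Qed.

Lemma invariant_right_half (m : {measure set (R * R) -> \bar R}) B :
  quadrant_invariant m -> measurable B -> B `<=` Q ->
  m B = m (B `&` [set p | 0 < p.1]).
Proof.
move=> minv mB BQ.
rewrite [LHS](@measureDI _ _ _ m _ [set p | 0 < p.1])//; last exact: measurable_right_half.
rewrite [X in (X + _)%E](_ : _ = 0%E) ?add0e//.
apply: invariant_axis_left0 => //.
  by apply: measurableD => //; exact: measurable_right_half.
by move=> p [/BQ Qp /negP]; rewrite -leNgt.
Qed.

Lemma invariant_upper_half (m : {measure set (R * R) -> \bar R}) B :
  quadrant_invariant m -> measurable B -> B `<=` Q ->
  m B = m (B `&` [set p | 0 < p.2]).
Proof.
move=> minv mB BQ.
rewrite [LHS](@measureDI _ _ _ m _ [set p | 0 < p.2])//; last exact: measurable_upper_half.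
rewrite [X in (X + _)%E](_ : _ = 0%E) ?add0e//.
apply: invariant_axis_bottom0 => //.
  by apply: measurableD => //; exact: measurable_upper_half.
by move=> p [/BQ Qp /negP]; rewrite -leNgt.
Qed.

Lemma measure_cap_small (m : {measure set (R * R) -> \bar R}) (F : (set (R * R))^nat) e :
  (m (F 0%N) < +oo)%E -> (forall n, measurable (F n)) -> nonincreasing_seq F ->
  m (\bigcap_n F n) = 0%E -> 0 < e -> exists n, fine (m (F n)) <= e.
Proof.
move=> F0 mF niF capF e0.
have := nonincreasing_cvg_mu F0 mF (bigcapT_measurable mF) niF.
rewrite capF => /fine_cvgP[_] /cvgrPdist_le /(_ _ e0)[n _ /(_ n (leqnn n))] /=.
rewrite sub0r normrN => /(le_trans (ler_norm _)) fe.
by exists n.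
Qed.

(** * Triangles in the region of linearity *)

Section local_linearity.
Context {a b c : R} (a0 : 0 < a) (b0 : 0 < b) (c0 : 0 < c) (cab : 1 <= c * (a * b)).
Context (sigma_lin : forall x : R, - b <= x <= b -> sigma x = a * x).

(** The factor [a] passes to the coordinates [(a u, w)], in which the linear parts of [h] and [v]
    are the elementary shears. *)
Definition triangle (x y : R) : set (R * R) :=
  Q `&` [set p | x * (a * p.1) + y * p.2 <= 1].

Definition hlin (p : R * R) : R * R := (p.1 + p.2 / a, p.2).
Definition vlin (p : R * R) : R * R := (p.1, a * p.1 + p.2).

Lemma sigmainv_lin y : 0 <= y <= a * b -> sigmainv y = y / a.
Proof.
move=> /andP[y0 yab]; have yE : sigma (y / a) = y.
  have ya0 : 0 <= y / a by rewrite divr_ge0// ltW.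
  rewrite sigma_lin; first by rewrite mulrCA mulfV ?mulr1// gt_eqF.
  apply/andP; split; last by rewrite ler_pdivrMr// mulrC.
  by apply: le_trans ya0; rewrite oppr_le0 ltW.
by rewrite -{1}yE sigmaK.
Qed.

Lemma triangle_le x y p : c <= x -> c <= y -> triangle x y p -> p.1 <= b /\ p.2 <= a * b.
Proof.
case: p => u w cx cy [[/= u0 w0]] le1.
have : c * (a * u) <= x * (a * u) by rewrite ler_wpM2r// mulr_ge0// ltW.
have : c * w <= y * w by rewrite ler_wpM2r.
have : 0 <= c * (a * u) by rewrite mulr_ge0 ?(ltW c0)// mulr_ge0// ltW.
have : 0 <= c * w by rewrite mulr_ge0// ltW.
move=> *; have wle : c * w <= c * (a * b) by apply: le_trans cab; lra.
have ule : c * (a * u) <= c * (a * b) by apply: le_trans cab; lra.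
by move: wle ule; rewrite !ler_pM2l.
Qed.

Lemma measurable_triangle x y : measurable (triangle x y).
Proof.
apply: measurableI; first exact: measurable_quadrant.
apply: measurable_le_set => //.
by apply: measurable_funD; apply: measurable_funM => //; apply: measurable_funM.
Qed.

Lemma triangle_sub x y x' y' : x <= x' -> y <= y' -> triangle x' y' `<=` triangle x y.
Proof.
move=> xx' yy' [u w] [[/= u0 w0]] le1; split => //=.
have : x * (a * u) <= x' * (a * u) by rewrite ler_wpM2r// mulr_ge0// ltW.
have : y * w <= y' * w by rewrite ler_wpM2r.
lra.
Qed.

(** Composing the form [x (a u) + y w] with [hlin] replaces [y] by [x + y]; both sides lie where [h]
    equals [hlin]. The set [S] allows sectors to be carried along. *)
Lemma pull_hmap_triangle x y (S : set (R * R)) : c <= x -> c <= y ->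
  Q `&` h @^-1` (triangle x y `&` S) =
  triangle x (x + y) `&` hlin @^-1` S.
Proof.
move=> cx cy; have x0 : 0 < x by exact: lt_le_trans cx.
have lin u w : x * (a * (u + w / a)) + y * w = x * (a * u) + (x + y) * w.
  by field; rewrite gt_eqF.
apply/seteqP; split=> -[u w] /=.
  move=> [[/= u0 w0] [Tp Sp]].
  have wE : sigmainv w = w / a.
    by apply: sigmainv_lin; rewrite w0 (triangle_le x y _ cx cy Tp).2.
  move: Tp Sp; rewrite /hmap/= wE => -[_ /=]; rewrite lin => le1 Sp.
  by split=> //; split.
move=> [Tp Sp]; have [[/= u0 w0] /= le1] := Tp.
have cxy : c <= x + y by rewrite ler_wpDr// (le_trans (ltW c0)).
have wE : sigmainv w = w / a.
  by apply: sigmainv_lin; rewrite w0 (triangle_le x (x + y) _ cx cxy Tp).2.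
split=> //; rewrite /hmap/= wE; split=> //; split=> //=; last by rewrite lin.
by split=> //=; rewrite addr_ge0// divr_ge0// ltW.
Qed.

Lemma pull_vmap_triangle x y (S : set (R * R)) : c <= x -> c <= y ->
  Q `&` v @^-1` (triangle x y `&` S) =
  triangle (x + y) y `&` vlin @^-1` S.
Proof.
move=> cx cy.
have lin u w : x * (a * u) + y * (a * u + w) = (x + y) * (a * u) + y * w by ring.
have uE u : 0 <= u -> u <= b -> sigma u = a * u.
  by move=> u0 ub; apply: sigma_lin; rewrite ub (le_trans _ u0)// oppr_le0 ltW.
apply/seteqP; split=> -[u w] /=.
  move=> [[/= u0 w0] [Tp Sp]].
  move: (Tp) Sp; rewrite /vmap/= (uE u u0 (triangle_le x y _ cx cy Tp).1).
  move=> -[_ /=]; rewrite lin => le1 Sp.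
  by split=> //; split.
move=> [Tp Sp]; have [[/= u0 w0] /= le1] := Tp.
have cxy : c <= x + y by rewrite ler_wpDr// (le_trans (ltW c0)).
split=> //; rewrite /vmap/= (uE u u0 (triangle_le (x + y) y _ cxy cy Tp).1).
split=> //; split=> //=; last by rewrite lin.
by split=> //=; rewrite addr_ge0// mulr_ge0// ltW.
Qed.

Section triangle_measure.
Context (m : {measure set (R * R) -> \bar R}) (minv : quadrant_invariant m).
Context (mfin : (m (triangle c c) < +oo)%E).

Lemma triangle_fin_num x y : c <= x -> c <= y -> m (triangle x y) \is a fin_num.
Proof.
move=> cx cy; rewrite ge0_fin_numE//; apply: le_lt_trans mfin.
by apply: le_measure; rewrite ?inE; [exact: measurable_triangle..|exact: triangle_sub].
Qed.

Lemma measure_triangle_split x y (S : set (R * R)) : measurable S -> c <= x -> c <= y ->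
  m (triangle x y `&` S) =
  (m (triangle x (x + y) `&` hlin @^-1` S) +
   m (triangle (x + y) y `&` vlin @^-1` S))%E.
Proof.
move=> mS cx cy; rewrite (invariant_split _ _ minv).
- by rewrite pull_hmap_triangle// pull_vmap_triangle.
- by apply: measurableI => //; exact: measurable_triangle.
- by move=> p [[]].
Qed.

(** Vanishing is continuity from above: when one coefficient tends to infinity, the triangles
    decrease to a subset of a half-axis. *)
Lemma triangle_mass_measure : triangle_mass c (fun x y => fine (m (triangle x y))).
Proof.
have cge u w : c <= u -> c <= w -> forall n, c <= w + u *+ n.
  move=> cu cw n; rewrite ler_wpDr// mulrn_wge0//.
  by rewrite (le_trans (ltW c0)).
have mono u n n' : c <= u -> (n <= n')%N -> u *+ n <= u *+ n'.
  by move=> cu; apply: ler_wpMn2l; rewrite (le_trans (ltW c0)).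
have large z u : 0 < z -> c <= u -> (forall n, u *+ n.+1 * z <= 1) -> False.
  move=> z0 cu H; have u0 : 0 < u by exact: lt_le_trans cu.
  have := H (Num.truncn (u * z)^-1); rewrite mulrnAl -mulr_natl leNgt => /negP; apply.
  by rewrite -ltr_pdivrMr ?mulr_gt0// div1r; exact: truncnS_gt.
split=> [x y cx cy|x y x' y' cx cy xx' yy'|x y cx cy|x y e cx cy e0|x y e cx cy e0].
- exact: fine_ge0.
- apply: fine_le; [by apply: triangle_fin_num; [exact: le_trans xx'|exact: le_trans yy']|
    exact: triangle_fin_num|].
  by apply: le_measure; rewrite ?inE; [exact: measurable_triangle..|exact: triangle_sub].
- have := measure_triangle_split x y setT measurableT cx cy.
  have TT u w (f : R * R -> R * R) : triangle u w `&` f @^-1` [set: R * R] = triangle u w.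
    by apply/seteqP; split=> p // [].
  have cxy : c <= x + y by rewrite ler_wpDr// (le_trans (ltW c0)).
  by rewrite setIT !TT => ->; rewrite fineD// triangle_fin_num.
- apply: (measure_cap_small m (fun n => triangle x (y + x *+ n.+1))) => //.
  + by have := triangle_fin_num _ _ cx (cge _ _ cx cy 1); rewrite ge0_fin_numE.
  + by move=> n; exact: measurable_triangle.
  + move=> n n' nn'; apply/subsetPset; apply: triangle_sub => //.
    by rewrite lerD2l mono.
  + case: minv => _ m0 _; apply: subset_measure0 m0.
    * by apply: bigcapT_measurable => n; exact: measurable_triangle.
    * exact: measurable_axes.2.
    move=> [u w] H; have [[/= u0 w0] _] := H 0%N I; split => //=.
    apply/eqP; rewrite eq_le w0 andbT leNgt; apply/negP => wpos.
    apply: (large w x wpos cx) => n; have [_ /=] := H n I.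
    have : 0 <= x * (a * u) by rewrite !mulr_ge0 ?(le_trans _ cx)// ltW.
    have : 0 <= y * w by rewrite mulr_ge0// (le_trans _ cy)// ltW.
    by rewrite mulrDl; lra.
- apply: (measure_cap_small m (fun n => triangle (x + y *+ n.+1) y)) => //.
  + by have := triangle_fin_num _ _ (cge _ _ cy cx 1) cy; rewrite ge0_fin_numE.
  + by move=> n; exact: measurable_triangle.
  + move=> n n' nn'; apply/subsetPset; apply: triangle_sub => //.
    by rewrite lerD2l mono.
  + case: minv => m0 _ _; apply: subset_measure0 m0.
    * by apply: bigcapT_measurable => n; exact: measurable_triangle.
    * exact: measurable_axes.1.
    move=> [u w] H; have [[/= u0 w0] _] := H 0%N I; split => //=.
    apply/eqP; rewrite eq_le u0 andbT leNgt; apply/negP => upos.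
    apply: (large (a * u) y (mulr_gt0 a0 upos) cy) => n; have [_ /=] := H n I.
    have : 0 <= x * (a * u) by rewrite !mulr_ge0 ?(le_trans _ cx)// ltW.
    have : 0 <= y * w by rewrite mulr_ge0// (le_trans _ cy)// ltW.
    by rewrite mulrDl; lra.
Qed.

Lemma triangle_measure_eq : exists2 S, 0 <= S &
  forall x y, c <= x -> c <= y -> m (triangle x y) = (S / (x * y))%:E.
Proof.
have [S S0 mS] := triangle_mass_eq _ _ c0 triangle_mass_measure.
exists S => // x y cx cy; rewrite -mS// fineK//; exact: triangle_fin_num.
Qed.

End triangle_measure.

(** * Comparison of two invariant measures *)

Section comparison.
Context (m1 m2 : {measure set (R * R) -> \bar R}).
Context (m1inv : quadrant_invariant m1) (m2inv : quadrant_invariant m2).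
Context (m1fin : (m1 (triangle c c) < +oo)%E).
Context (m12 : forall x y, c <= x -> c <= y -> m1 (triangle x y) = m2 (triangle x y)).

(** Slope at most [i / j] in the coordinates [(a u, w)]. Clearing the denominator makes [j = 0] the
    full quadrant, and [i = 0 < j] the bottom axis, within the quadrant. *)
Definition sector (i j : nat) : set (R * R) :=
  [set p | j%:R * p.2 <= i%:R * (a * p.1)].

Lemma measurable_sector i j : measurable (sector i j).
Proof.
by apply: measurable_le_set; apply: measurable_funM => //; apply: measurable_funM.
Qed.

(** Euclidean algorithm on [(i, j)]: after splitting the triangle, the sector becomes everything or
    [sector i (j - i)] in one piece, and flat or [sector (i - j) j] in the other. Every nontrivial
    case has a smaller [i + j]. *)
Lemma triangle_sector_eq i j x y : c <= x -> c <= y ->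
  m1 (triangle x y `&` sector i j) = m2 (triangle x y `&` sector i j).
Proof.
have whole u w (S : set (R * R)) : c <= u -> c <= w -> Q `<=` S ->
    m1 (triangle u w `&` S) = m2 (triangle u w `&` S).
  move=> cu cw QS; rewrite setIidl; first exact: m12.
  by move=> p [/QS].
have flat u w (S : set (R * R)) : measurable S -> (forall p, Q p -> S p -> p.2 <= 0) ->
    m1 (triangle u w `&` S) = m2 (triangle u w `&` S).
  move=> mS S0; have mTS : measurable (triangle u w `&` S).
    by apply: measurableI => //; exact: measurable_triangle.
  by rewrite !invariant_axis_bottom0// => p [[Qp _] Sp]; split=> //; exact: S0.
have [n] := ubnP (i + j); elim: n i j x y => // n IH i j x y ijn cx cy.
have cxy : c <= x + y by rewrite ler_wpDr// (le_trans (ltW c0)).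
case: j ijn => [|j] ijn.
  apply: whole => // -[u w] [/= u0 w0]; rewrite /sector/= mul0r.
  by rewrite mulr_ge0// mulr_ge0// ltW.
case: i ijn => [|i] ijn.
  apply: flat => [|[u w] _]; first exact: measurable_sector.
  by rewrite /sector/= mul0r pmulr_rle0.
rewrite (measure_triangle_split m1)//; last exact: measurable_sector.
rewrite (measure_triangle_split m2)//; last exact: measurable_sector.
have hE u w : i.+1%:R * (a * (u + w / a)) = i.+1%:R * (a * u) + i.+1%:R * w.
  by field; rewrite gt_eqF.
have mlin (f : R * R -> R * R) S : measurable_fun setT f -> measurable S -> measurable (f @^-1` S).
  exact: measurable_preimageT.
congr (_ + _)%E.
- have [ji|ij] := leP j.+1 i.+1.
    apply: whole => // -[u w] [/= u0 w0]; rewrite /sector/hlin/= hE.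
    have : j.+1%:R * w <= i.+1%:R * w by rewrite ler_wpM2r// ler_nat.
    have : 0 <= i.+1%:R * (a * u) by rewrite mulr_ge0// mulr_ge0// ltW.
    lra.
  have -> : hlin @^-1` sector i.+1 j.+1 = sector i.+1 (j.+1 - i.+1).
    apply/seteqP; split=> -[u w]; rewrite /sector/hlin/= hE natrB 1?ltnW// mulrBl; lra.
  by apply: IH => //; lia.
- have [ij|ji] := leP i.+1 j.+1.
    apply: flat => [|[u w] [/= u0 w0]].
      apply: mlin; last exact: measurable_sector.
      by apply: measurable_fun_pair => //; apply: measurable_funD => //; apply: measurable_funM.
    rewrite /sector/vlin/= mulrDr => le1.
    have : i.+1%:R * (a * u) <= j.+1%:R * (a * u).
      by rewrite ler_wpM2r ?ler_nat// mulr_ge0// ltW.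
    move=> le2; have : j.+1%:R * w <= 0 by lra.
    by rewrite pmulr_rle0.
  have -> : vlin @^-1` sector i.+1 j.+1 = sector (i.+1 - j.+1) j.+1.
    apply/seteqP; split=> -[u w]; rewrite /sector/vlin/= natrB 1?ltnW// mulrBl mulrDr; lra.
  by apply: IH => //; lia.
Qed.

(* Slope of [p], up to the factor [a], and value at [p] of the linear form
   defining [triangle 1 1].  The inverse is written as a [powR] because
   [measurable_powR] makes it measurable. *)
Definition slope_height (p : R * R) : R * R :=
  (p.2 * (a * p.1) `^ (-1), a * p.1 + p.2).

Definition of_slope_height (p : R * R) : R * R :=
  (p.2 * (1 + p.1) `^ (-1) / a, p.1 * (p.2 * (1 + p.1) `^ (-1))).

Lemma measurable_slope_height : measurable_fun setT slope_height.
Proof.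
apply: measurable_fun_pair.
  apply: measurable_funM => //.
  apply: (@measurableT_comp _ _ _ _ _ _ (@powR R ^~ (-1))); first exact: measurable_powR.
  exact: measurable_funM.
by apply: measurable_funD => //; apply: measurable_funM.
Qed.

Lemma measurable_of_slope_height : measurable_fun setT of_slope_height.
Proof.
have mV : measurable_fun setT (fun p : R * R => p.2 * (1 + p.1) `^ (-1)).
  apply: measurable_funM => //.
  apply: (@measurableT_comp _ _ _ _ _ _ (@powR R ^~ (-1))); first exact: measurable_powR.
  exact: measurable_funD.
by apply: measurable_fun_pair; apply: measurable_funM.
Qed.

Lemma slope_heightK p : Q p -> 0 < p.1 -> of_slope_height (slope_height p) = p.
Proof.
case: p => u w [/= _ w0] u0; rewrite /of_slope_height /slope_height/=.
have au0 : 0 < a * u by rewrite mulr_gt0.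
rewrite (powR_inv1 (ltW au0)) powR_inv1; last first.
  by rewrite addr_ge0// divr_ge0// ltW.
have auw : a * u + w != 0 by rewrite gt_eqF// ltr_pwDl.
by congr (_, _); field; rewrite auw !gt_eqF.
Qed.

(** In these coordinates a rational quadrant cuts out, when not empty, a smaller triangle
    [triangle t t] intersected with a sector, up to the null vertical axis; these are the sets of
    [triangle_sector_eq]. *)
Lemma triangle_slope_height_eq A : measurable A ->
  m1 (slope_height @^-1` A `&` (triangle c c `&` [set p | 0 < p.1])) =
  m2 (slope_height @^-1` A `&` (triangle c c `&` [set p | 0 < p.1])).
Proof.
have mD : measurable (triangle c c `&` [set p : R * R | 0 < p.1]).
  by apply: measurableI; [exact: measurable_triangle|exact: measurable_right_half].
have [m1' m1E] := restricted_image_measure _ _ _ _ _ m1 _ _ measurable_slope_height mD.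
have [m2' m2E] := restricted_image_measure _ _ _ _ _ m2 _ _ measurable_slope_height mD.
move=> mA; rewrite -m1E -m2E; apply: measure_unique_quadrants => //.
  rewrite m1E preimage_setT setTI; apply: le_lt_trans m1fin.
  by apply: le_measure; rewrite ?inE//; exact: measurable_triangle.
move=> p q; rewrite m1E m2E.
set D := slope_height @^-1` _ `&` _.
have [p0|p0] := ltP (ratr p : R) 0.
  suff -> : D = set0 by rewrite !measure0.
  apply/seteqP; split=> -[u w] // [[/=]]; rewrite !in_itv/= => wp _ [[[/= u0 w0] _] _].
  by move: (le_lt_trans wp p0); rewrite ltNge mulr_ge0// powR_ge0.
have [q0|q0] := leP (ratr q : R) 0.
  suff -> : D = set0 by rewrite !measure0.
  apply/seteqP; split=> -[u w] // [[/=]]; rewrite !in_itv/= => _ wq [[[/= _ w0] _] u0].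
  by move: (le_trans wq q0); rewrite leNgt ltr_pwDl// mulr_gt0.
pose t := Num.max c (ratr q)^-1.
have ct : c <= t by rewrite le_max lexx.
have t0 : 0 < t by exact: lt_le_trans ct.
pose i := `|numq p|%N; pose j := `|denq p|%N.
have j0 : 0 < j%:R :> R by rewrite ltr0n absz_gt0 denq_neq0.
have pE : ratr p = i%:R / j%:R :> R.
  rewrite /ratr /i /j !natr_absz !ger0_norm//.
  by rewrite numq_ge0 -(ler0q R).
have -> : D = triangle t t `&` sector i j `&` [set p | 0 < p.1].
  rewrite /D; apply/seteqP; split=> -[u w] /=; rewrite !in_itv/=.
    move=> [[wp wq] [[[/= u0 w0] /= le1] upos]]; split=> //.
    have au0 : 0 < a * u by rewrite mulr_gt0.
    split.
      split=> //=; rewrite -mulrDr /t maxEle; case: ifP => _; last by rewrite mulrDr.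
      by rewrite mulrC ler_pdivrMr// mul1r.
    move: wp; rewrite /sector/= (powR_inv1 (ltW au0)) pE ler_pdivrMr// mulrAC ler_pdivlMr//.
    by rewrite mulrC.
  move=> [[[[/= u0 w0] /= le1] le2] upos].
  have au0 : 0 < a * u by rewrite mulr_gt0.
  have au0' : 0 <= a * u + w by rewrite addr_ge0// ltW.
  have le3 : t * (a * u + w) <= 1 by rewrite mulrDr.
  split; last first.
    split=> //; split=> //=; rewrite -mulrDr; apply: le_trans le3.
    by rewrite ler_wpM2r.
  split.
    rewrite (powR_inv1 (ltW au0)) pE ler_pdivrMr// mulrAC ler_pdivlMr//.
    by rewrite mulrC.
  have : (ratr q)^-1 * (a * u + w) <= 1.
    by apply: le_trans le3; rewrite ler_wpM2r// le_max lexx orbT.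
  by rewrite mulrC ler_pdivrMr// mul1r.
have mTS : measurable (triangle t t `&` sector i j).
  by apply: measurableI; [exact: measurable_triangle|exact: measurable_sector].
by rewrite -!invariant_right_half ?triangle_sector_eq// => ? [[]].
Qed.

(** Off the vertical axis [slope_height] has a Borel left inverse, so every Borel set there is a
    preimage under it. *)
Lemma triangle_eq A : measurable A -> A `<=` triangle c c -> m1 A = m2 A.
Proof.
move=> mA AT; have AQ : A `<=` Q by move=> p /AT[].
rewrite (invariant_right_half m1)// (invariant_right_half m2)//.
have -> : A `&` [set p | 0 < p.1] =
    slope_height @^-1` (of_slope_height @^-1` A) `&` (triangle c c `&` [set p | 0 < p.1]).
  apply/seteqP; split=> p /=.
    by move=> [Ap p0]; rewrite slope_heightK//; [split=> //; split=> //; exact: AT|exact: AQ].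
  by move=> [+ [[Qp _] p0]]; rewrite slope_heightK.
apply: triangle_slope_height_eq; apply: measurable_preimageT => //.
exact: measurable_of_slope_height.
Qed.

(* [euclid n p]: the subtractive algorithm inverting [h] and [v] brings [p]
   into [triangle c c] or onto an axis in at most [n] steps. *)
Definition terminal : set (R * R) :=
  triangle c c `|` [set p | p.1 <= 0] `|` [set p | p.2 <= 0].

Fixpoint euclid n : set (R * R) := if n is n'.+1 then
    terminal `|` [set p | (sigmainv p.2 <= p.1 -> euclid n' (hinv p)) /\
                          (sigma p.1 <= p.2 -> euclid n' (vinv p))]
  else terminal.

Lemma measurable_euclid n : measurable (euclid n).
Proof.
have mX0 : measurable (euclid 0).
  by apply: measurableU; [apply: measurableU; [exact: measurable_triangle|]|];
    exact: measurable_le_set.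
elim: n => // n IH; apply: measurableU => //.
have impl (C D : set (R * R)) : measurable C -> measurable D -> measurable [set p | C p -> D p].
  move=> mC mD; have -> : [set p | C p -> D p] = ~` C `|` D.
    by apply/seteqP; split=> p /=; have [] := pselect (C p); tauto.
  by apply: measurableU => //; exact: measurableC.
apply: measurableI; apply: impl.
- exact: measurable_hsector.
- by apply: measurable_preimageT IH; exact: measurable_hinv.
- exact: measurable_vsector.
- by apply: measurable_preimageT IH; exact: measurable_vinv.
Qed.

Lemma euclid_homo n : euclid n `<=` euclid n.+1.
Proof.
elim: n => [|n IH] p; first by left.
case=> [p0|[ph pv]]; [by left|right].
by split=> [/ph|/pv]; exact: IH.
Qed.

(** On the curve [sigma u = w] both inverse maps land on an axis; elsewhere only one of the two
    implications in [euclid] is active. *)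
Lemma euclid_step u w :
  (sigmainv w < u -> exists n, euclid n (u - sigmainv w, w)) ->
  (u < sigmainv w -> exists n, euclid n (u, w - sigma u)) ->
  exists n, euclid n (u, w).
Proof.
move=> Uh Uv; case: (ltgtP (sigmainv w) u) => [lt|lt|eq].
- have [n Un] := Uh lt; exists n.+1; right; split=> //=.
  by rewrite -sigmainv_ge leNgt lt.
- have [n Un] := Uv lt; exists n.+1; right; split=> //=.
  by rewrite leNgt lt.
- have swu : sigma u = w by rewrite -eq sigmainvK.
  exists 1%N; right; split=> _; rewrite /hinv /vinv/= ?eq ?swu subrr.
    by left; right; rewrite /= lexx.
  by right; rewrite /= lexx.
Qed.

(** The potential [u / dr + w / dt] drops by at least 1 at an [hinv] step with [w >= t] and at a
    [vinv] step with [u >= r]. Other steps subtract a fixed positive amount from one coordinate, so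
    only finitely many occur in a row. *)
Lemma euclid_cover : Q `<=` \bigcup_n euclid n.
Proof.
have U0 (u w : R) : u <= 0 \/ w <= 0 -> exists n, euclid n (u, w).
  by case=> le0; exists 0%N; [left; right|right].
(* The box [[0, r] x [0, t]] lies in [triangle c c], its far corner being on the hypotenuse. *)
pose r := (2 * (c * a))^-1; pose t := (2 * c)^-1.
have [r0 t0] : 0 < r /\ 0 < t by rewrite !invr_gt0 !mulr_gt0.
have UT (u w : R) : 0 <= u <= r -> 0 <= w <= t -> exists n, euclid n (u, w).
  move=> /andP[u0 ur] /andP[w0 wt]; exists 0%N; left; left; split=> //=.
  have -> : 1 = c * (a * r) + c * t by rewrite /r /t; field; rewrite !gt_eqF.
  by apply: lerD; rewrite !ler_pM2l.
pose dr := sigmainv t; pose dt := sigma r.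
have dt0 : 0 < dt by rewrite -sigma_0; exact: sigma_incr.
have dr0 : 0 < dr by rewrite ltNge sigmainv_le sigma_0 -ltNge.
have arch (x y : R) : 0 < y -> exists n, x <= y *+ n.
  move=> y0; exists (Num.truncn (x / y)).+1; rewrite -[_ *+ _]mulr_natl -ler_pdivrMr//.
  by apply: ltW; exact: truncnS_gt.
have main k (u w : R) : 0 <= u -> 0 <= w -> u / dr + w / dt <= k%:R -> exists n, euclid n (u, w).
  elim: k u w => [|k IH] u w u0 w0 uwk.
    have : u / dr <= 0.
      by apply: le_trans uwk; rewrite lerDl divr_ge0// ltW.
    by rewrite ler_pdivrMr// mul0r => ?; apply: U0; left.
  have IHh (u' w' : R) : t <= w' -> sigmainv w' <= u' -> u' / dr + w' / dt <= k.+1%:R ->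
      exists n, euclid n (u' - sigmainv w', w').
    move=> tw wu uw'; apply: IH; rewrite ?subr_ge0//; first exact: le_trans (ltW t0) tw.
    have : 1 <= sigmainv w' / dr.
      by rewrite ler_pdivlMr// mul1r /dr sigmainv_le sigmainvK.
    by move: uw'; rewrite -natr1 mulrBl; lra.
  have IHv (u' w' : R) : r <= u' -> sigma u' <= w' -> u' / dr + w' / dt <= k.+1%:R ->
      exists n, euclid n (u', w' - sigma u').
    move=> ru uw uw'; apply: IH; rewrite ?subr_ge0//; first exact: le_trans (ltW r0) ru.
    have : 1 <= sigma u' / dt by rewrite ler_pdivlMr// mul1r /dt sigma_mono.
    by move: uw'; rewrite -natr1 mulrBl; lra.
  (* For [u' <= r], [vinv] steps keep [u'] and subtract [sigma u'], until [w' <= t] or an [hinv]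
     step lowers the potential. *)
  have low j (u' w' : R) : 0 <= u' <= r -> 0 <= w' <= sigma u' *+ j ->
      u' / dr + w' / dt <= k.+1%:R -> exists n, euclid n (u', w').
    elim: j w' => [|j IHj] w' ur /andP[w0' wj] uw'; first by apply: U0; right.
    have [wt|tw] := leP w' t; first by apply: UT => //; rewrite w0'.
    apply: euclid_step => [lt|lt]; first by apply: IHh => //; exact: ltW.
    have uw : sigma u' <= w' by rewrite -sigmainv_ge ltW.
    apply: IHj => //; first by rewrite subr_ge0 uw/= lerBlDl -mulrS.
    apply: le_trans uw'; rewrite lerD2l ler_pM2r ?invr_gt0//.
    by rewrite lerBlDr lerDl sigma_ge0//; case/andP: ur.
  have low' (u' w' : R) : 0 <= u' <= r -> 0 <= w' -> u' / dr + w' / dt <= k.+1%:R ->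
      exists n, euclid n (u', w').
    move=> /andP[u0' ur] w0' uw'; have [|upos] := leP u' 0; first by move=> ?; apply: U0; left.
    have [j wj] := arch w' (sigma u') ltac:(by rewrite -sigma_0; exact: sigma_incr).
    by apply: (low j); rewrite ?u0' ?w0'.
  have [|wpos] := leP w 0; first by move=> ?; apply: U0; right.
  have sw0 : 0 < sigmainv w.
    by rewrite ltNge sigmainv_le sigma_0 -ltNge.
  have [j uj] := arch u _ sw0.
  (* Likewise for [u > r]: [hinv] steps subtract the constant [sigmainv w], until [u <= r] or a
     [vinv] step lowers the potential. *)
  elim: j u u0 uwk uj => [|j IHj] u u0 uwk uj; first by apply: U0; left.
  have [ur|ru] := leP u r; first by apply: low' => //; rewrite u0.
  apply: euclid_step => [lt|lt]; last first.
    by apply: IHv; rewrite ?(ltW ru)// -sigmainv_ge ltW.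
  apply: IHj; rewrite ?subr_ge0 ?(ltW lt)//; last by rewrite lerBlDl -mulrS.
  apply: le_trans uwk; rewrite lerD2r ler_pM2r ?invr_gt0//.
  by rewrite lerBlDr lerDl ltW.
move=> [u w] [/= u0 w0].
have [k uwk] := arch (u / dr + w / dt) 1 ltr01.
by have [n Un] := main k u w u0 w0 uwk; exists n.
Qed.

(** The terminal part lies in the triangle up to the axes; the rest splits by invariance into two
    pulled-back sets, each contained in [euclid] of one step less. *)
Lemma euclid_eq n A : measurable A -> A `<=` Q -> A `<=` euclid n -> m1 A = m2 A.
Proof.
have X0_eq B : measurable B -> B `<=` Q -> B `<=` euclid 0 -> m1 B = m2 B.
  move=> mB BQ BX.
  have mBr : measurable (B `&` [set p | 0 < p.1]).
    by apply: measurableI => //; exact: measurable_right_half.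
  have BrQ : B `&` [set p | 0 < p.1] `<=` Q by move=> p [/BQ].
  rewrite !(invariant_right_half _ B)// !(invariant_upper_half _ (B `&` _))//.
  apply: triangle_eq; first by apply: measurableI => //; exact: measurable_upper_half.
  move=> p [[Bp /= p1] p2]; case: (BX _ Bp) => [[//|]|] /=; rewrite leNgt.
    by rewrite p1.
  by rewrite p2.
elim: n A => [|n IH] A mA AQ AX; first exact: X0_eq.
have mX := measurable_euclid 0.
rewrite (@measureDI _ _ _ m1 _ (euclid 0))// (@measureDI _ _ _ m2 _ (euclid 0))//.
congr (_ + _)%E; last first.
  by apply: X0_eq; [exact: measurableI|move=> p [/AQ]|move=> p []].
have mAX : measurable (A `\` euclid 0) by exact: measurableD.
have AXQ : A `\` euclid 0 `<=` Q by move=> p [/AQ].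
rewrite [LHS](invariant_split m1 _ m1inv mAX AXQ) [RHS](invariant_split m2 _ m2inv mAX AXQ).
congr (_ + _)%E; apply: IH.
- by apply: measurable_pull => //; exact: measurable_hmap.
- exact: subIsetl.
- move=> [u w] [[/= u0 w0] [/AX[//|[+ _]] _]]; rewrite /hmap /hinv/= addrK.
  by apply; rewrite lerDr.
- by apply: measurable_pull => //; exact: measurable_vmap.
- exact: subIsetl.
- move=> [u w] [[/= u0 w0] [/AX[//|[_ +]] _]]; rewrite /vmap /vinv/= addrAC subrr add0r.
  by apply; rewrite lerDl.
Qed.

Lemma quadrant_eq A : measurable A -> A `<=` Q -> m1 A = m2 A.
Proof.
move=> mA AQ; have mAX n : measurable (A `&` euclid n).
  by apply: measurableI => //; exact: measurable_euclid.
have AE : \bigcup_n (A `&` euclid n) = A.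
  by rewrite -setI_bigcupr setIidl// => p /AQ /euclid_cover.
have cvgA (m : {measure set (R * R) -> \bar R}) : m (A `&` euclid n) @[n --> \oo] --> m A.
  rewrite -[X in _ --> m X]AE; apply: nondecreasing_cvg_mu => //; first by rewrite AE.
  apply/nondecreasing_seqP => n; apply/subsetPset; apply: setIS; exact: euclid_homo.
have E : (fun n => m1 (A `&` euclid n)) = (fun n => m2 (A `&` euclid n)).
  by apply/funext => n; apply: (euclid_eq n) => // p [/AQ].
have := cvgA m1; rewrite E => c1.
exact: (cvg_unique _ c1 (cvgA m2)).
Qed.

End comparison.
End local_linearity.
End invariant_measures.

(** * Lebesgue measure of the plane *)

Section plane_lebesgue_measure.
Context {R : realType}.
Local Notation mu := (@lebesgue_measure R).

Lemma lebesgue_measure_shift (x : R) (A : set R) : measurable A ->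
  mu [set y | A (y + x)] = mu A.
Proof.
move=> mA.
have mshift : measurable_fun setT (fun y : measurableTypeR R => y + x : measurableTypeR R).
  exact: measurable_funD.
have [m' m'E] := restricted_image_measure _ _ _ _ _ mu _ _ mshift measurableT.
have E B : m' B = mu [set y | B (y + x)] by rewrite m'E setIT.
rewrite -E; apply/esym; apply: lebesgue_measure_unique => // _ [[s t] _ <-].
rewrite E [X in _ = mu X](_ : _ = `]s - x, t - x]%classic).
  rewrite !lebesgue_measure_itv/= !lte_fin ltrD2r; case: ifPn => // _.
  by rewrite -!EFinB; congr EFin; ring.
by apply/seteqP; split=> y /=; rewrite !in_itv/= ltrBlDr lerBrDr.
Qed.

Local Notation plane_lebesgue := ((mu \x mu)%E : set (R * R) -> \bar R).

(* [lebesgue_measure] lives on [measurableTypeR R], whose display differs from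
   that of [R] although the measurable sets are the same. *)
Lemma plane_lebesgue_measure :
  exists m : {measure set (R * R) -> \bar R}, forall A, m A = plane_lebesgue A.
Proof.
have mid : @measurable_fun _ _ (measurableTypeR R * measurableTypeR R)%type (R * R)%type setT id.
  by move=> _ B mB; rewrite setTI.
have [m mE] := restricted_image_measure _ _ _ _ _ (mu \x mu)%E _ _ mid measurableT.
by exists m => A; rewrite mE setIT.
Qed.

Lemma plane_lebesgueE A : measurable A -> plane_lebesgue A = (mu \x^ mu)%E A.
Proof.
move=> mA; apply: product_measure_unique => //= B D mB mD.
by rewrite product_measure2E.
Qed.

(** By Fubini, the measure is the integral of the lengths of horizontal sections, and the section at
    height [y] is translated by [f y]. *)
Lemma plane_lebesgue_hmap (f : R -> R) (A : set (R * R)) : measurable A ->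
  measurable (hmap f @` A) -> plane_lebesgue (hmap f @` A) = plane_lebesgue A.
Proof.
move=> mA mhA; rewrite !plane_lebesgueE//; apply: eq_integral => y _ /=.
rewrite -(lebesgue_measure_shift (f y) (ysection (hmap f @` A) y)); last exact: measurable_ysection.
congr (mu _); apply/seteqP; split=> x; rewrite /ysection/= !inE/=.
  by move=> [[u w] Auw]; rewrite /hmap/= => -[+ wy]; rewrite -wy => /addIr <-.
by move=> Axy; exists (x, y).
Qed.

Lemma plane_lebesgue_vmap (f : R -> R) (A : set (R * R)) : measurable A ->
  measurable (vmap f @` A) -> plane_lebesgue (vmap f @` A) = plane_lebesgue A.
Proof.
move=> mA mvA; apply: eq_integral => x _ /=.
rewrite -(lebesgue_measure_shift (f x) (xsection (vmap f @` A) x)); last exact: measurable_xsection.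
congr (mu _); apply/seteqP; split=> y; rewrite /xsection/= !inE/=.
  by move=> [[u w] Auw]; rewrite /vmap/= => -[<-]; rewrite addrC => /addIr <-.
by move=> Axy; exists (x, y) => //; rewrite /vmap/= addrC.
Qed.

Lemma lebesgue_invariant_normalized (sigma sigmainv : R -> R) :
  continuous sigma -> continuous sigmainv ->
  sigma_invariant_normalized sigma sigmainv plane_lebesgue.
Proof.
move=> cs csi.
have mhalf : measurable [set y : R | 0 <= y].
  rewrite (_ : [set _ | _] = `[0, +oo[%classic); first exact: measurable_itv.
  by apply/seteqP; split=> y /=; rewrite in_itv/= andbT.
split.
- have mu01 : mu `[0, 1]%classic = 1%E.
    by rewrite lebesgue_measure_itv/= lte_fin ltr01 sube0.
  by rewrite [LHS]product_measure1E// -[RHS]mule1; congr (_ * _)%E; exact: mu01.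
- by rewrite [LHS]product_measure1E// [X in (X * _)%E](lebesgue_measure_set1 (0 : R)) mul0e.
- by rewrite [LHS]product_measure1E// [X in (_ * X)%E](lebesgue_measure_set1 (0 : R)) mule0.
- move=> A mA AQ; split; apply/esym.
    apply: plane_lebesgue_hmap => //; rewrite image_hmap.
    by apply: measurable_preimageT => //; exact: measurable_hinv.
  apply: plane_lebesgue_vmap => //; rewrite image_vmap.
  by apply: measurable_preimageT => //; exact: measurable_vinv.
Qed.

End plane_lebesgue_measure.

(** * Scaling and normalization on the unit square *)

Lemma invariant_mscale {R : realType} (sigma sigmainv : R -> R) (r : {nonneg R})
    (m : {measure set (R * R) -> \bar R}) :
  @quadrant_invariant R sigma sigmainv m -> @quadrant_invariant R sigma sigmainv (mscale r m).
Proof.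
move=> [ml mb minv]; rewrite /mscale; split=> [||A mA AQ]; rewrite ?ml ?mb ?mule0//.
by rewrite -(minv A mA AQ).1 -(minv A mA AQ).2.
Qed.

Theorem theorem3 (R : realType) (sigma sigmainv : R -> R)
  (Hinv1 : cancel sigma sigmainv) (Hinv2 : cancel sigmainv sigma)
  (Hcont : continuous sigma) (Hcontinv : continuous sigmainv)
  (Hincr : forall x y : R, x < y -> sigma x < sigma y)
  (Hodd : forall x : R, sigma (- x) = - sigma x)
  (a b : R) (Ha : 0 < a) (Hb : 0 < b)
  (Hlin : forall x : R, - b <= x <= b -> sigma x = a * x) :
  sigma_invariant_normalized sigma sigmainv
    ((@lebesgue_measure R) \x (@lebesgue_measure R))%E /\
  forall mu : {measure set (R * R)%type -> \bar R},
    sigma_invariant_normalized sigma sigmainv mu ->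
    forall A : set (R * R), measurable A -> A `<=` @quadrant R ->
      mu A = ((@lebesgue_measure R) \x (@lebesgue_measure R))%E A.
Proof.
have lamP := lebesgue_invariant_normalized sigma sigmainv Hcont Hcontinv.
split; first exact: lamP.
move=> mu muP.
have [lam lamE] := @plane_lebesgue_measure R.
have {lamP}lamP : sigma_invariant_normalized sigma sigmainv lam.
  have -> : (lam : set (R * R) -> \bar R) =
      ((@lebesgue_measure R) \x (@lebesgue_measure R))%E by apply/funext => A; exact: lamE.
  exact: lamP.
have sigma_0 : sigma 0 = 0.
  by have := Hodd 0; rewrite oppr0 => s0; lra.
(* The three summands give [c >= 1] and [c a >= 1], which put [triangle c c] in the unit square and
   make its mass finite, and [c (a b) >= 1], which puts it where both maps are linear. *)
pose c := 1 + a^-1 + (a * b)^-1.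
have a10 : 0 < a^-1 by rewrite invr_gt0.
have ab10 : 0 < (a * b)^-1 by rewrite invr_gt0 mulr_gt0.
have c0 : 0 < c by rewrite !addr_gt0.
have c1 : 1 <= c by rewrite /c; lra.
have ca : 1 <= c * a by rewrite -ler_pdivrMr// div1r /c; lra.
have cab : 1 <= c * (a * b).
  by rewrite -ler_pdivrMr ?mulr_gt0// div1r /c; lra.
have inv (m : set (R * R) -> \bar R) : sigma_invariant_normalized sigma sigmainv m ->
    @quadrant_invariant R sigma sigmainv m by case.
pose sq : set (R * R) := `[0, 1]%classic `*` `[0, 1]%classic.
have msq : measurable sq by apply: measurableX; exact: measurable_itv.
have sqQ : sq `<=` @quadrant R.
  by move=> [u w]; rewrite /sq/= !in_itv/= => -[/andP[? _] /andP[? _]].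
have Tsq : @triangle R a c c `<=` sq.
  move=> [u w] [[/= u0 w0] le1]; rewrite /sq/= !in_itv/= u0 w0/=.
  have : 1 * u <= c * a * u by rewrite ler_wpM2r.
  have : 1 * w <= c * w by rewrite ler_wpM2r.
  have : 0 <= c * (a * u) by rewrite !mulr_ge0// ltW.
  have : 0 <= c * w by rewrite mulr_ge0// ltW.
  by rewrite !mul1r -mulrA => *; split; lra.
have fin (m : {measure set (R * R) -> \bar R}) :
    sigma_invariant_normalized sigma sigmainv m -> (m (@triangle R a c c) < +oo)%E.
  move=> [msq1 _ _ _]; apply: (@le_lt_trans _ _ (m sq)).
    by apply: le_measure; rewrite ?inE//; exact: measurable_triangle.
  by rewrite [ltLHS]msq1 ltry.
have quad_eq := @quadrant_eq R sigma sigmainv Hinv1 Hinv2 Hcont Hcontinv Hincr sigma_0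
  a b c Ha Hb c0 cab Hlin.
have tri_eq := @triangle_measure_eq R sigma sigmainv Hinv1 Hinv2 Hcont Hcontinv Hincr
  a b c Ha Hb c0 cab Hlin.
have [S S0 muS] := tri_eq mu (inv _ muP) (fin _ muP).
have [L L0 lamL] := tri_eq lam (inv _ lamP) (fin _ lamP).
have SL : S = L.
  have [[musq _ _ _] [lamsq _ _ _]] := (muP, lamP).
  (* Both scaled measures give [S L / (x y)] to the triangles. Scaling both sides avoids dividing by
     constants that might a priori vanish. *)
  have : (L%:E * mu sq = S%:E * lam sq)%E.
    apply: (quad_eq (mscale (NngNum L0) mu) (mscale (NngNum S0) lam)) => //.
    - exact: (invariant_mscale _ _ _ _ (inv _ muP)).
    - exact: (invariant_mscale _ _ _ _ (inv _ lamP)).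
    - by rewrite /mscale/= lte_mul_pinfty// fin.
    - move=> x y cx cy.
      change ((L%:E * mu (@triangle R a x y) = S%:E * lam (@triangle R a x y))%E).
      rewrite (muS _ _ cx cy) (lamL _ _ cx cy) -!EFinM; congr EFin.
      by rewrite !mulrA (mulrC S).
  by rewrite [mu sq]musq [lam sq]lamsq !mule1 => -[].
move=> A mA AQ; rewrite -lamE; apply: (quad_eq mu lam) => //; [exact: inv|exact: inv|exact: fin|].
by move=> x y cx cy; rewrite muS// lamL// SL.
Qed.
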